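(* Let $M$ be a smooth $7$-manifold with a $G_2$-structure $\varphi$, with octonion bundle $\mathbb{O}M$ and octonion covariant derivative $D$. Suppose $A,B\in\Gamma(\mathbb{O}M)$ and $X\in\Gamma(TM)$. Then $$D_X(AB)=(\nabla_XA)B+A(D_XB).$$
   Context: Setting. A $G_2$-structure on a smooth $7$-manifold $M$ is identified with a positive $3$-form $\varphi$, i.e. one that at each point lies in the $GL(7,\mathbb{R})$-orbit of $\varphi_0=e^{123}+e^{145}+e^{167}+e^{246}-e^{257}-e^{347}-e^{356}$. It determines a unique Riemannian metric $g$ and volume form $\mathrm{vol}$ (hence an orientation) by $g(u,v)\,\mathrm{vol}=\frac16(u\lrcorner\varphi)\wedge(v\lrcorner\varphi)\wedge\varphi$, where $\lrcorner$ is contraction. Let $*$ be the Hodge star, $\psi=*\varphi$, and $\nabla$ the Levi-Civita connection of $g$. Octonion bundle. $\mathbb{O}M=\Lambda^0\oplus TM$, where $\Lambda^0$ is the trivial real line bundle; an octonion section is $A=(a,\alpha)$ with $a$ a function and $\alpha$ a vector field; vector fields are identified with imaginary octonion sections. Inner product: $\langle (a,\alpha),(b,\beta)\rangle=ab+g(\alpha,\beta)$. Cross product: $\langle\alpha\times\beta,\gamma\rangle=\varphi(\alpha,\beta,\gamma)$. Octonion product: $AB=(ab-\langle\alpha,\beta\rangle,\ a\beta+b\alpha+\alpha\times\beta)$. Torsion and $D$. The torsion tensor $T_{ab}$ of $\varphi$ is the $2$-tensor with $\nabla_a\varphi_{bcd}=2T_a{}^{e}\psi_{ebcd}$. For a vector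 field $X$, $T_X=(0,X\lrcorner T)$ is the imaginary octonion section with vector part $X^aT_a{}^b$. Set $\nabla_X(a,\alpha)=(\nabla_Xa,\nabla_X\alpha)$ and define the octonion covariant derivative by $D_XA=\nabla_XA-A\,T_X$ (octonion product). *)

(* Defs.v *)
From mathcomp Require Import all_boot all_order all_algebra all_fingroup.
From mathcomp Require Import all_classical all_reals all_analysis.

Set Implicit Arguments.
Unset Strict Implicit.
Unset Printing Implicit Defensive.

Import Order.TTheory GRing.Theory Num.Theory.
Import numFieldNormedType.Exports.

Local Open Scope classical_set_scope.
Local Open Scope ring_scope.

(* [U] is meant to be open.  Since R^n is finite-dimensional, [df] is C^k iff
   [x |-> df_x(v)] is C^k for every fixed vector [v]. *)
Fixpoint Ck (R : realType) (n : nat) (W : normedModType R) (k : nat)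
    (U : set 'rV[R]_n) (f : 'rV[R]_n -> W) : Prop :=
  match k with
  | 0%N => forall x, U x -> {for x, continuous f}
  | k'.+1 => (forall x, U x -> differentiable f x) /\
             (forall v, Ck k' U (fun x => 'd f x v))
  end.

Definition smooth_on (R : realType) (n : nat) (W : normedModType R)
    (U : set 'rV[R]_n) (f : 'rV[R]_n -> W) : Prop :=
  forall k, Ck k U f.

(* A homeomorphism from an open subset of [M] onto an open subset of R^n; the
   two maps are total, with junk values outside these sets. *)
Record chart (R : realType) (n : nat) (M : topologicalType) := Chart {
  chart_dom : set M ;
  chart_to : M -> 'rV[R]_n ;
  chart_of : 'rV[R]_n -> M ;
  chart_dom_open : open chart_dom ;
  chart_img_open : open (chart_to @` chart_dom) ;
  chart_toK : forall p, chart_dom p -> chart_of (chart_to p) = p ;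
  chart_to_cont : forall p, chart_dom p -> {for p, continuous chart_to} ;
  chart_of_cont : forall x, (chart_to @` chart_dom) x ->
    {for x, continuous chart_of}
}.

Definition chart_img (R : realType) (n : nat) (M : topologicalType)
    (c : chart R n M) : set 'rV[R]_n := chart_to c @` chart_dom c.

Record smoothManifold (R : realType) (n : nat) := SmoothManifold {
  carrier :> topologicalType ;
  manifold_hausdorff : hausdorff_space carrier ;
  manifold_second_countable : @second_countable carrier ;
  atlas : set (chart R n carrier) ;
  atlas_cover : forall p : carrier, exists c, atlas c /\ chart_dom c p ;
  atlas_compatible : forall c c', atlas c -> atlas c' ->
    smooth_on (chart_to c @` (chart_dom c `&` chart_dom c'))
              (chart_to c' \o chart_of c)
}.

(* A chosen chart around [p].  The tangent space T_pM is represented by R^n,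
   a vector standing for the tangent vector with these components in the chart
   [chart_at p].  Since the chosen chart varies with [p], components must be
   transported to a fixed chart before any differentiation. *)
Definition chart_at (R : realType) (n : nat) (M : smoothManifold R n) (p : M) :
  chart R n M := sval (cid (atlas_cover p)).

Section Fields.
Context (R : realType) (n : nat) (M : smoothManifold R n).

(* The components in the chart [c] of the tangent vector [v] at [p]. *)
Definition to_chart (c : chart R n M) (p : M) (v : 'rV[R]_n) : 'rV[R]_n :=
  'd (chart_to c \o chart_of (chart_at p)) (chart_to (chart_at p) p) v.

(* The tangent vector at [p] whose components in the chart [c] are [x]. *)
Definition of_chart (c : chart R n M) (p : M) (x : 'rV[R]_n) : 'rV[R]_n :=
  'd (chart_to (chart_at p) \o chart_of c) (chart_to c p) x.

Definition smooth_fun (f : M -> R) : Prop :=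
  forall c, atlas c -> smooth_on (chart_img c) (f \o chart_of c).

Definition vfield := M -> 'rV[R]_n.

Definition smooth_vfield (X : vfield) : Prop :=
  forall c, atlas c ->
    smooth_on (chart_img c)
      (fun x => to_chart c (chart_of c x) (X (chart_of c x))).

Definition vderiv (X : vfield) (f : M -> R) : M -> R := fun p =>
  'd (f \o chart_of (chart_at p)) (chart_to (chart_at p) p) (X p).

(* A covariant k-tensor at a point takes k tangent vectors, given as the rows
   of a k x n matrix. *)
Definition tfield (k : nat) := M -> 'M[R]_(k, n) -> R.

Definition smooth_tfield (k : nat) (w : tfield k) : Prop :=
  forall c, atlas c -> forall v : 'M[R]_(k, n),
    smooth_on (chart_img c)
      (fun x => w (chart_of c x)
                  (\matrix_(i < k) of_chart c (chart_of c x) (row i v))).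

End Fields.

Definition multilinear (R : realType) (k n : nat) (w : 'M[R]_(k, n) -> R) :=
  forall (i : 'I_k) (a : R) (A B C : 'M[R]_(k, n)),
    row i A = a *: row i B + row i C ->
    row' i B = row' i A -> row' i C = row' i A ->
    w A = a * w B + w C.

Definition alternating (R : realType) (k n : nat) (w : 'M[R]_(k, n) -> R) :=
  forall (i j : 'I_k) (A : 'M[R]_(k, n)),
    i != j -> row i A = row j A -> w A = 0.

Definition is_form (R : realType) (k n : nat) (w : 'M[R]_(k, n) -> R) : Prop :=
  multilinear w /\ alternating w.

Definition wedge (R : realType) (k l n : nat)
    (a : 'M[R]_(k, n) -> R) (b : 'M[R]_(l, n) -> R) :
    'M[R]_(k + l, n) -> R := fun v =>
  ((k`! * l`!)%N%:R)^-1 *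
  \sum_(s : 'S_(k + l)) (-1) ^+ s *
     (a (usubmx (row_perm s v)) * b (dsubmx (row_perm s v))).

Definition contract (R : realType) (k n : nat) (u : 'rV[R]_n)
    (w : 'M[R]_(1 + k, n) -> R) : 'M[R]_(k, n) -> R :=
  fun v => w (col_mx u v).

Definition ev2 (R : realType) (n : nat) (w : 'M[R]_(1 + 1, n) -> R)
    (u v : 'rV[R]_n) : R := w (col_mx u v).

Definition is_inner (R : realType) (n : nat) (g : 'M[R]_(2, n) -> R) : Prop :=
  [/\ multilinear g,
      (forall u v, ev2 g u v = ev2 g v u) &
      (forall u, u != 0 -> 0 < ev2 g u u)].

(* The basis consists of the rows of [e]. *)
Definition orthonormal (R : realType) (n : nat) (g : 'M[R]_(2, n) -> R)
    (e : 'M[R]_n) : Prop :=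
  forall i j : 'I_n, ev2 g (row i e) (row j e) = (i == j)%:R.

(* The two volume forms of [g] correspond to the two orientations. *)
Definition is_volume (R : realType) (n : nat) (g : 'M[R]_(2, n) -> R)
    (vol : 'M[R]_(n, n) -> R) : Prop :=
  is_form vol /\ forall e, orthonormal g e -> `|vol e| = 1.

(* The inner product of two k-forms, computed in the orthonormal basis [e];
   it is normalised so that the [e^{i_1 ... i_k}], i_1 < ... < i_k, are
   orthonormal. *)
Definition form_inner (R : realType) (k n : nat) (e : 'M[R]_n)
    (a b : 'M[R]_(k, n) -> R) : R :=
  (k`!%:R)^-1 * \sum_(I : {ffun 'I_k -> 'I_n}) a (rowsub I e) * b (rowsub I e).

(* [b' = * b] for the metric [g] and the orientation given by [vol], where [n]
   is [k + l]. *)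
Definition is_hodge_star (R : realType) (k l n : nat) (g : 'M[R]_(2, n) -> R)
    (vol : 'M[R]_(k + l, n) -> R)
    (b : 'M[R]_(k, n) -> R) (b' : 'M[R]_(l, n) -> R) : Prop :=
  is_form b' /\
  forall a, is_form a -> forall e, orthonormal g e ->
    forall v, wedge a b' v = form_inner e a b * vol v.

(* The vector dual to the linear form [f], i.e. index raising. *)
Definition sharp (R : realType) (n : nat) (g : 'M[R]_(2, n) -> R)
    (f : 'rV[R]_n -> R) : 'rV[R]_n :=
  xget 0 [set u | forall v, ev2 g u v = f v].

Section Connection.
Context (R : realType) (n : nat) (M : smoothManifold R n).

Definition riemannian (g : tfield M 2) : Prop :=
  smooth_tfield g /\ forall p, is_inner (g p).

(* (nabla_X w)(Y_1, ..., Y_k) *)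
Definition cov_deriv (nabla : vfield M -> vfield M -> vfield M) (k : nat)
    (X : vfield M) (w : tfield M k) (Y : 'I_k -> vfield M) : M -> R := fun p =>
  vderiv X (fun q => w q (\matrix_(j < k) Y j q)) p
  - \sum_(i < k) w p (\matrix_(j < k) if j == i then nabla X (Y j) p
                                      else Y j p).

(* Nothing is required of a connection on non-smooth fields. *)
Definition is_connection (nabla : vfield M -> vfield M -> vfield M) : Prop :=
  [/\ (forall X Y, smooth_vfield X -> smooth_vfield Y ->
         smooth_vfield (nabla X Y)),
      (forall (f : M -> R) X X' Y, smooth_fun f ->
         smooth_vfield X -> smooth_vfield X' -> smooth_vfield Y ->
         forall p, nabla (fun q => f q *: X q + X' q) Y p
                   = f p *: nabla X Y p + nabla X' Y p),
      (forall X Y Y', smooth_vfield X -> smooth_vfield Y -> smooth_vfield Y' ->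
         forall p, nabla X (fun q => Y q + Y' q) p
                   = nabla X Y p + nabla X Y' p) &
      (forall (f : M -> R) X Y, smooth_fun f ->
         smooth_vfield X -> smooth_vfield Y ->
         forall p, nabla X (fun q => f q *: Y q) p
                   = vderiv X f p *: Y p + f p *: nabla X Y p)].

(* nabla_X Y - nabla_Y X = [X, Y], tested on functions. *)
Definition torsion_free (nabla : vfield M -> vfield M -> vfield M) : Prop :=
  forall X Y (f : M -> R), smooth_vfield X -> smooth_vfield Y -> smooth_fun f ->
    forall p, vderiv (fun q => nabla X Y q - nabla Y X q) f p
              = vderiv X (vderiv Y f) p - vderiv Y (vderiv X f) p.

Definition metric_compatible (g : tfield M 2)
    (nabla : vfield M -> vfield M -> vfield M) : Prop :=
  forall X (Y : 'I_2 -> vfield M), smooth_vfield X ->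
    (forall i, smooth_vfield (Y i)) -> forall p, cov_deriv nabla X g Y p = 0.

Definition levi_civita (g : tfield M 2)
    (nabla : vfield M -> vfield M -> vfield M) : Prop :=
  [/\ is_connection nabla, torsion_free nabla & metric_compatible g nabla].

End Connection.

(* e^{ijk}, with indices numbered from 1 to 7 *)
Definition e3 (R : realType) (i j k : nat) (v : 'M[R]_(3, 7)) : R :=
  \det (colsub (tnth [tuple (inord i.-1 : 'I_7); inord j.-1; inord k.-1]) v).

Definition phi0 (R : realType) (v : 'M[R]_(3, 7)) : R :=
  e3 1 2 3 v + e3 1 4 5 v + e3 1 6 7 v + e3 2 4 6 v
  - e3 2 5 7 v - e3 3 4 7 v - e3 3 5 6 v.

Definition positive_form (R : realType) (w : 'M[R]_(3, 7) -> R) : Prop :=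
  exists2 E : 'M[R]_7, E \in unitmx & forall v, w v = phi0 (v *m E).

Section G2.
Context (R : realType) (M : smoothManifold R 7).

Definition G2_structure (phi : tfield M 3) : Prop :=
  smooth_tfield phi /\ forall p, is_form (phi p) /\ positive_form (phi p).

Definition G2_metric_volume (phi : tfield M 3) (g : tfield M 2)
    (vol : tfield M 7) : Prop :=
  [/\ riemannian g,
      smooth_tfield vol,
      (forall p, is_volume (g p) (vol p)) &
      (forall p u v (w : 'M[R]_(7, 7)),
         ev2 (g p) u v * vol p w =
         6%:R^-1 *
         wedge (wedge (@contract R 2 7 u (phi p)) (@contract R 2 7 v (phi p)))
               (phi p) w)].

Definition hodge_dual_field (g : tfield M 2) (vol : tfield M 7)
    (phi : tfield M 3) (psi : tfield M 4) : Prop :=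
  smooth_tfield psi /\
  forall p, @is_hodge_star R 3 4 7 (g p) (vol p) (phi p) (psi p).

(* The vector field X -| T, with components X^a T_a^b. *)
Definition contract_sharp (g T : tfield M 2) (X : vfield M) : vfield M :=
  fun p => sharp (g p) (fun v => ev2 (T p) (X p) v).

(* nabla_a phi_{bcd} = 2 T_a^e psi_{ebcd} *)
Definition torsion_tensor (g : tfield M 2) (phi : tfield M 3)
    (psi : tfield M 4) (nabla : vfield M -> vfield M -> vfield M)
    (T : tfield M 2) : Prop :=
  [/\ smooth_tfield T,
      (forall p, multilinear (T p)) &
      (forall X (Y : 'I_3 -> vfield M), smooth_vfield X ->
         (forall i, smooth_vfield (Y i)) -> forall p,
         cov_deriv nabla X phi Y p =
         2%:R * @contract R 3 7 (contract_sharp g T X p) (psi p)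
                  (\matrix_(j < 3) Y j p))].

Definition octfield := M -> R * 'rV[R]_7.

Definition smooth_octfield (A : octfield) : Prop :=
  smooth_fun (fun p => (A p).1) /\ smooth_vfield (fun p => (A p).2).

Definition cross (g : tfield M 2) (phi : tfield M 3) (p : M)
    (u v : 'rV[R]_7) : 'rV[R]_7 :=
  sharp (g p) (@contract R 1 7 v (@contract R 2 7 u (phi p))).

Definition oct_mul (g : tfield M 2) (phi : tfield M 3) (A B : octfield) :
    octfield := fun p =>
  ((A p).1 * (B p).1 - ev2 (g p) (A p).2 (B p).2,
   (A p).1 *: (B p).2 + (B p).1 *: (A p).2 + cross g phi p (A p).2 (B p).2).

Definition oct_nabla (nabla : vfield M -> vfield M -> vfield M)
    (X : vfield M) (A : octfield) : octfield := fun p =>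
  (vderiv X (fun q => (A q).1) p, nabla X (fun q => (A q).2) p).

Definition oct_torsion (g T : tfield M 2) (X : vfield M) : octfield :=
  fun p => (0, contract_sharp g T X p).

Definition oct_D (g : tfield M 2) (phi : tfield M 3)
    (nabla : vfield M -> vfield M -> vfield M) (T : tfield M 2)
    (X : vfield M) (A : octfield) : octfield := fun p =>
  oct_nabla nabla X A p - oct_mul g phi A (oct_torsion g T X) p.

End G2.

(* Main.v *)
(** The torsion enters through the identity
    nabla_X (u x v) = (nabla_X u) x v + u x (nabla_X v) + 2 psi(T_X, u, v, .)^#,
    obtained by differentiating <u x v, w> = phi(u, v, w), and
    2 psi(t, u, v, .)^# is the associator (uv)t - u(vt) of the octonion product.
    Hence nabla_X (AB) = (nabla_X A) B + A (nabla_X B) + (AB) T_X - A (B T_X),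
    which is the claim.  Pointwise, phi is the pullback of phi_0 by a linear
    isomorphism E; the formula for g vol gives g up to a factor c, the
    normalisation of the volume form gives c^9 = 1, and the Hodge star evaluated
    on an orthonormal basis (e_1, ..., e_7) gives
    psi(e_4, ..., e_7) = phi(e_1, e_2, e_3) vol(e_1, ..., e_7).  The relation
    between psi and the associator is then a finite check on basis vectors. *)

(* The wedge product is a sum over all permutations with real coefficients, so the finite checks
   cannot be run on the definitions. Forms with constant integer coefficients are therefore mirrored
   by lists of signed monomials, evaluated by repeated contraction; soundness lemmas carry the
   integers computed there over to the real forms. The Hodge star is only characterised by its
   pairing with all forms, so a single value of psi is extracted by pairing with one monomial of the
   dual coframe. The other obstacle is analytic. The axioms of a connection say nothing about
   non-smooth fields, so every field that is differentiated or used as a test field must first be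
   shown smooth. The cross product and T_X both arise by raising an index, which is defined by a
   choice at each point; its smoothness comes from the inverse Gram matrix of the metric in a
   chart. *)
From HB Require Import structures.
Require Import Defs.
From mathcomp Require Import all_boot all_order all_algebra all_fingroup.
From mathcomp Require Import all_classical all_reals all_analysis.
From mathcomp Require Import ring.
Import Order.TTheory GRing.Theory Num.Theory.
Import numFieldNormedType.Exports.
Local Open Scope ring_scope.

Set Implicit Arguments.
Unset Strict Implicit.
Unset Printing Implicit Defensive.

(** * Alternating forms and the wedge product *)

Section RowOperations.
Context (R : realType) (k n : nat).
Implicit Types (w : 'M[R]_(k, n) -> R) (A : 'M[R]_(k, n)).

Definition rset (i : 'I_k) (u : 'rV[R]_n) A : 'M[R]_(k, n) :=
  \matrix_(m < k) if m == i then u else row m A.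

Lemma row_rset i u A : row i (rset i u A) = u.
Proof. by rewrite rowK eqxx. Qed.

Lemma row'_rset i u A : row' i (rset i u A) = row' i A.
Proof. by apply/matrixP=> x y; rewrite !mxE eq_sym (negbTE (neq_lift _ _)) mxE. Qed.

Lemma rset_id i A : rset i (row i A) A = A.
Proof. by apply/row_matrixP=> m; rewrite rowK; case: eqP => // ->. Qed.

Lemma multilinear_rset w i a u v A : multilinear w ->
  w (rset i (a *: u + v) A) = a * w (rset i u A) + w (rset i v A).
Proof. by move=> wL; apply: (wL i); rewrite ?row_rset // !row'_rset. Qed.

(** A permutation is a product of transpositions, and for one transposition the sign comes from
    polarisation: with all other rows fixed, the form is bilinear in rows [i] and [j] and vanishes
    on the diagonal. *)
Lemma form_row_perm w (s : 'S_k) A : is_form w ->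
  w (row_perm s A) = (-1) ^+ s * w A.
Proof.
case=> wL wA; have [ts -> {s}] := prod_tpermP s.
elim: ts A => [|[i j] ts IH] A /=; first by rewrite big_nil odd_perm1 row_perm1 mul1r.
case/andP; rewrite /dpair /= => nij /IH {}IH.
rewrite big_cons row_permM odd_mul_tperm nij signr_addb mulN1r /=.
have swap B : w (row_perm (tperm i j) B) = - w B.
  pose F u v := w (rset i u (rset j v B)).
  have FDl u u' v : F (u + u') v = F u v + F u' v.
    by rewrite /F -[u]scale1r multilinear_rset // mul1r scale1r.
  have rsetC u v : rset i u (rset j v B) = rset j v (rset i u B).
    apply/row_matrixP=> m; rewrite !rowK; case: eqP => [->|].
      by rewrite (negbTE nij) // rowK eqxx.
    by move=> nmi; case: eqP => // _; rewrite rowK; case: eqP.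
  have FDr u v v' : F u (v + v') = F u v + F u v'.
    by rewrite /F !rsetC -[v]scale1r multilinear_rset // mul1r scale1r.
  have F0 u : F u u = 0.
    by apply: (wA i j) => //; rewrite row_rset rsetC row_rset.
  have := F0 (row i B + row j B).
  rewrite FDl !FDr !F0 add0r addr0 => /eqP; rewrite addrC addr_eq0 => /eqP FE.
  have -> : w B = F (row i B) (row j B).
    by rewrite /F rset_id rset_id.
  rewrite -[in RHS]FE; congr (w _); apply/row_matrixP=> m.
  have -> : row m (row_perm (tperm i j) B) = row (tperm i j m) B.
    by apply/rowP=> c; rewrite !mxE.
  rewrite rowK; case: tpermP => [->|->|/eqP/negbTE-> /eqP/negbTE]; rewrite ?eqxx //.
    by rewrite eq_sym (negbTE nij) rowK eqxx.
  move=> nmj; by rewrite rowK nmj.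
by rewrite swap IH mulNr.
Qed.
End RowOperations.

Section BlockPermutations.
Context (k l : nat).

Definition dsum_fun (t : 'S_k) (t' : 'S_l) (i : 'I_(k + l)) : 'I_(k + l) :=
  match fintype.split i with inl a => lshift l (t a) | inr b => rshift k (t' b) end.

Lemma dsum_fun_l t t' a : dsum_fun t t' (lshift l a) = lshift l (t a).
Proof. by rewrite /dsum_fun -[lshift l a]/(unsplit (inl a)) unsplitK. Qed.

Lemma dsum_fun_r t t' b : dsum_fun t t' (rshift k b) = rshift k (t' b).
Proof. by rewrite /dsum_fun -[rshift k b]/(unsplit (inr b)) unsplitK. Qed.

Lemma dsum_fun_inj t t' : injective (dsum_fun t t').
Proof.
move=> i j; case: (split_ordP i) => a ->; case: (split_ordP j) => b ->;
  rewrite ?dsum_fun_l ?dsum_fun_r.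
- by move/lshift_inj/perm_inj->.
- by move/eqP; rewrite eq_lrshift.
- by move/eqP; rewrite eq_rlshift.
- by move/rshift_inj/perm_inj->.
Qed.

Definition perm_dsum t t' : 'S_(k + l) := perm (@dsum_fun_inj t t').

(** The sign is read off as a determinant, since the permutation matrix is block diagonal. *)
Lemma sign_perm_dsum (R : realType) t t' :
  (-1) ^+ perm_dsum t t' = (-1) ^+ t * (-1) ^+ t' :> R.
Proof.
rewrite -!(det_perm R) -(det_ublock _ 0).
suff -> : perm_mx (perm_dsum t t') =
  block_mx (perm_mx t) 0 0 (perm_mx t') :> 'M[R]_(k + l) by [].
apply/matrixP=> i j; rewrite 2!mxE permE /=.
case: (split_ordP i) => a ->; case: (split_ordP j) => b ->.
- by rewrite dsum_fun_l block_mxEul !mxE (inj_eq (@lshift_inj _ _)).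
- by rewrite dsum_fun_l block_mxEur mxE eq_lrshift.
- by rewrite dsum_fun_r block_mxEdl mxE eq_rlshift.
- by rewrite dsum_fun_r block_mxEdr !mxE (inj_eq (@rshift_inj _ _)).
Qed.

(** Expanding both block determinants gives a sum over pairs (t, t'). For each pair, reindexing [s]
    by the block permutation turns the inner sum into the full Leibniz formula, so there are k! l!
    copies of the determinant. This is what cancels the normalisation of [wedge]. *)
Lemma sum_det_blocks (R : realType) (m : 'M[R]_(k + l)) :
  \sum_(s : 'S_(k + l)) (-1) ^+ s *
     (\det (lsubmx (usubmx (row_perm s m))) * \det (rsubmx (dsubmx (row_perm s m))))
  = (k`! * l`!)%N%:R * \det m.
Proof.
transitivity (\sum_(t : 'S_k) \sum_(t' : 'S_l) \sum_(s : 'S_(k + l))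
    (-1) ^+ (perm_dsum t t')^-1%g * (-1) ^+ s *
     \prod_i m (s i) (perm_dsum t t' i)).
  under [RHS]eq_bigr do rewrite exchange_big /=.
  rewrite [RHS]exchange_big /=; apply: eq_bigr => s _.
  rewrite big_distrlr /= mulr_sumr; apply: eq_bigr => t _.
  rewrite mulr_sumr; apply: eq_bigr => t' _.
  rewrite odd_permV sign_perm_dsum big_split_ord /=.
  set P1 := \prod_i _; set P2 := \prod_i _.
  set Q1 := \prod_i _; set Q2 := \prod_i _.
  have -> : P1 = Q1 by apply: eq_bigr => i _; rewrite !mxE permE /= dsum_fun_l.
  have -> : P2 = Q2 by apply: eq_bigr => i _; rewrite !mxE permE /= dsum_fun_r.
  move: (_ ^+ s) (_ ^+ t) (_ ^+ t') => x y z; move: Q1 Q2 => q1 q2.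
  by rewrite mulrACA !mulrA; congr (_ * _ * _); rewrite -mulrA mulrC.
have detE t t' : \sum_(s : 'S_(k + l)) (-1) ^+ (perm_dsum t t')^-1%g * (-1) ^+ s *
     \prod_i m (s i) (perm_dsum t t' i) = \det m.
  rewrite -det_tr /determinant [RHS](reindex_inj (mulgI (perm_dsum t t')^-1%g)) /=.
  apply: eq_bigr => s _; rewrite odd_permM signr_addb; congr (_ * _).
  rewrite [RHS](reindex_inj (@perm_inj _ (perm_dsum t t'))) /=.
  by apply: eq_bigr => i _; rewrite !mxE permM permK.
under eq_bigr => t _ do (under eq_bigr do rewrite detE; rewrite sumr_const card_Sn).
by rewrite sumr_const card_Sn -mulrnA mulr_natl mulnC.
Qed.
End BlockPermutations.

Section FormsPullback.
Context (R : realType).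

Lemma wedge_mulmx k l m n (a : 'M[R]_(k, n) -> R) (b : 'M[R]_(l, n) -> R)
    (E : 'M[R]_(m, n)) (v : 'M[R]_(k + l, m)) :
  wedge a b (v *m E) = wedge (fun x => a (x *m E)) (fun x => b (x *m E)) v.
Proof.
rewrite /wedge; congr (_ * _); apply: eq_bigr => s _.
by rewrite !row_permE mulmxA -mul_usub_mx -mul_dsub_mx.
Qed.

Lemma row'_mulmx k m n (i : 'I_k) (A : 'M[R]_(k, m)) (E : 'M[R]_(m, n)) :
  row' i (A *m E) = row' i A *m E.
Proof. by apply/matrixP=> x y; rewrite !mxE; apply: eq_bigr => j _; rewrite mxE. Qed.

Lemma is_form_mulmx k m n (a : 'M[R]_(k, n) -> R) (E : 'M[R]_(m, n)) :
  is_form a -> is_form (fun x => a (x *m E)).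
Proof.
case=> aL aA; split.
  move=> i c A B C AE BE CE; apply: (aL i); rewrite ?row'_mulmx ?BE ?CE //.
  by rewrite !row_mul AE mulmxDl scalemxAl.
by move=> i j A nij AE; apply: (aA i j) => //; rewrite !row_mul AE.
Qed.

Lemma is_form_det_colsub k n (I : 'I_k -> 'I_n) :
  is_form (fun v : 'M[R]_(k, n) => \det (colsub I v)).
Proof.
split.
  move=> i c A B C AE BE CE; rewrite -[X in _ + X]mul1r.
  apply: (determinant_multilinear (i0 := i)).
  - move/rowP: AE => AE; apply/rowP=> j; have := AE (I j).
    by rewrite !mxE mul1r.
  - by move/matrixP: BE => BE; apply/matrixP=> x y; have := BE x (I y); rewrite !mxE.
  - by move/matrixP: CE => CE; apply/matrixP=> x y; have := CE x (I y); rewrite !mxE.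
move=> i j A nij /rowP AE; apply: (determinant_alternate nij) => x.
by have := AE (I x); rewrite !mxE.
Qed.

(* Only the block permutations contribute to the sum defining the wedge
   product, and on these [b] is a multiple of a determinant. *)
Lemma wedge_det_lsubmx k l (b : 'M[R]_(l, k + l) -> R) : is_form b ->
  wedge (fun x : 'M[R]_(k, k + l) => \det (lsubmx x)) b 1%:M =
  b (row_mx 0 1%:M).
Proof.
move=> bF; rewrite /wedge.
have termE (s : 'S_(k + l)) :
    \det (lsubmx (usubmx (row_perm s 1%:M))) * b (dsubmx (row_perm s 1%:M)) =
    \det (lsubmx (usubmx (row_perm s 1%:M))) *
      \det (rsubmx (dsubmx (row_perm s (1%:M : 'M[R]_(k + l))))) *
      b (row_mx 0 1%:M).
  have [/forallP sl|] :=
    boolP [forall i, [exists a, s (lshift l i) == lshift l a]]; last first.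
    (* If some index of the first block leaves it, the first determinant has a zero row. *)
    rewrite negb_forall => /existsP [i]; rewrite negb_exists => /forallP si.
    rewrite (_ : \det _ = 0) ?mul0r // (expand_det_row _ i) big1 // => j _.
    by rewrite !mxE (negbTE (si j)) mul0r.
  have /choice [f fE] : forall i, exists a, s (lshift l i) = lshift l a.
    by move=> i; have /existsP [a /eqP] := sl i; exists a.
  have f_inj : injective f.
    by move=> i j fij; apply: (@lshift_inj k l); apply: (@perm_inj _ s); rewrite !fE fij.
  have /choice [h hE] : forall j, exists c, s (rshift k j) = rshift k c.
    move=> j; case: (split_ordP (s (rshift k j))) => c cE; last by exists c.
    (* An injection of a finite set is onto, so [f] already takes every value in the first block and
       no later index can land there. *)
    have /codomP [i ci] := injF_onto f_inj c.
    move: cE; rewrite ci -fE => /perm_inj /eqP; by rewrite eq_rlshift.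
  have h_inj : injective h.
    by move=> i j hij; apply: (@rshift_inj k l); apply: (@perm_inj _ s); rewrite !hE hij.
  have dE : dsubmx (row_perm s 1%:M) =
      row_perm (perm h_inj) (row_mx 0 1%:M) :> 'M[R]_(l, k + l).
    apply/matrixP=> i j; rewrite !mxE permE hE.
    by case: (split_ordP j) => c ->; rewrite ?mxE ?eq_rlshift ?eq_rshift.
  rewrite -mulrA; congr (_ * _); rewrite dE form_row_perm //; congr (_ * _).
  rewrite -(det_perm R) (_ : rsubmx _ = perm_mx (perm h_inj)) //.
  by apply/matrixP=> i j; rewrite mxE mxE row_mxEr !mxE.
under eq_bigr do rewrite termE mulrA.
rewrite -mulr_suml sum_det_blocks det1 mulr1 mulKf //.
Qed.

(** The first form is the monomial e^{1...k} of the coframe dual to [e]. It vanishes on basis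
    vectors unless the index map permutes the first k indices; there both factors change by the same
    sign, so the k! surviving terms are equal and cancel the normalisation. *)
Lemma form_inner_det_lsubmx k l (b : 'M[R]_(k, k + l) -> R) (e : 'M[R]_(k + l)) :
  is_form b -> e \in unitmx ->
  form_inner e (fun x => \det (lsubmx (x *m invmx e))) b = b (usubmx e).
Proof.
move=> bF eU; rewrite /form_inner.
have detE (I : {ffun 'I_k -> 'I_(k + l)}) :
    \det (lsubmx (rowsub I e *m invmx e)) =
    \sum_(t : 'S_k) (-1) ^+ t * \prod_i (I i == lshift l (t i))%:R.
  rewrite mul_rowsub_mx mulmxV //; apply: eq_bigr => t _; congr (_ * _).
  by apply: eq_bigr => i _; rewrite !mxE.
under eq_bigr do rewrite detE mulr_suml.
rewrite exchange_big /= (eq_bigr (fun=> b (usubmx e))) => [|t _]; last first.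
  rewrite (bigD1 [ffun i => lshift l (t i)]) //= [X in _ + X]big1 ?addr0.
    rewrite big1 ?mulr1 => [|i _]; last by rewrite ffunE eqxx.
    rewrite (_ : rowsub _ e = row_perm t (usubmx e)); last first.
      by apply/matrixP=> i j; rewrite !mxE ffunE.
    by rewrite form_row_perm // mulrA -signr_addb addbb mul1r.
  move=> I; apply: contraNeq => nz; apply/eqP/ffunP=> i; rewrite ffunE; apply/eqP.
  apply: contraNT nz => ni; rewrite (bigD1 i) //= (negbTE ni) mul0r mulr0.
  by rewrite mul0r.
rewrite sumr_const card_Sn -[b _ *+ _]mulr_natl mulKf //.
Qed.

(** The defining property of the star is tested on e^{1...k} and evaluated on the frame [e] itself:
    the wedge product then isolates the value of [b'] on the last l vectors, and the inner product
    that of [b] on the first k. *)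
Lemma hodge_star_orthonormal k l (g : 'M[R]_(2, k + l) -> R)
    (vol : 'M[R]_(k + l) -> R) (b : 'M[R]_(k, k + l) -> R)
    (b' : 'M[R]_(l, k + l) -> R) (e : 'M[R]_(k + l)) :
  is_form b -> is_hodge_star g vol b b' -> Defs.orthonormal g e -> e \in unitmx ->
  b' (dsubmx e) = b (usubmx e) * vol e.
Proof.
move=> bF [b'F starE] eO eU.
pose a := fun x : 'M[R]_(k, k + l) => \det (lsubmx (x *m invmx e)).
have aF : is_form a.
  apply: (is_form_mulmx (a := fun x => \det (lsubmx x))).
  suff -> : (fun x : 'M[R]_(k, k + l) => \det (lsubmx x)) =
      fun x => \det (colsub (lshift l) x).
    exact: is_form_det_colsub.
  by apply/funext => x; rewrite lsubmxEsub.
have := starE _ aF _ eO e; rewrite form_inner_det_lsubmx // => <-.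
rewrite -{2}[e]mul1mx wedge_mulmx.
have -> : (fun x => a (x *m e)) = (fun x => \det (lsubmx x)).
  by apply/funext => x; rewrite /a mulmxK.
rewrite wedge_det_lsubmx; last exact: is_form_mulmx.
by rewrite -{2}[e]vsubmxK mul_row_col mul0mx mul1mx add0r.
Qed.
End FormsPullback.

(** * Constant forms on R^7 as lists *)

Section WedgeBilinear.
Context (R : realType) (k l n : nat) (I : Type) (r : seq I) (c : I -> R).

Lemma wedge_suml (a : I -> 'M[R]_(k, n) -> R) (b : 'M[R]_(l, n) -> R) v :
  wedge (fun x => \sum_(i <- r) c i * a i x) b v =
  \sum_(i <- r) c i * wedge (a i) b v.
Proof.
rewrite /wedge; under [RHS]eq_bigr do rewrite mulrCA mulr_sumr.
rewrite -mulr_sumr exchange_big /=; congr (_ * _); apply: eq_bigr => s _.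
rewrite mulr_suml mulr_sumr; apply: eq_bigr => i _.
by rewrite -[c i * _ * _]mulrA mulrCA.
Qed.

Lemma wedge_sumr (a : 'M[R]_(k, n) -> R) (b : I -> 'M[R]_(l, n) -> R) v :
  wedge a (fun x => \sum_(i <- r) c i * b i x) v =
  \sum_(i <- r) c i * wedge a (b i) v.
Proof.
rewrite /wedge; under [RHS]eq_bigr do rewrite mulrCA mulr_sumr.
rewrite -mulr_sumr exchange_big /=; congr (_ * _); apply: eq_bigr => s _.
rewrite 2!mulr_sumr; apply: eq_bigr => i _.
by rewrite [a _ * _]mulrCA [LHS]mulrCA.
Qed.
End WedgeBilinear.

(* A list of pairs (c, [:: i1; ...; ik]) stands for the k-form on R^7 which is
   the sum of the c e^{i1 ... ik}, with indices numbered from 0. *)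
Definition mform (R : realType) (k : nat) (s : seq nat) (v : 'M[R]_(k, 7)) : R :=
  \det (colsub (fun i : 'I_k => inord (nth 0%N s i)) v).

Definition lform (R : realType) (k : nat) (L : seq (int * seq nat))
    (v : 'M[R]_(k, 7)) : R :=
  \sum_(m <- L) m.1%:~R * mform m.2 v.

Definition bas (R : realType) (k : nat) (J : seq nat) : 'M[R]_(k, 7) :=
  \matrix_(i < k) delta_mx 0 (inord (nth 0%N J i)).

(** The length and range conditions keep the default values of [nth] and [inord] out of the
    evaluation. *)
Definition lform_wf (k : nat) (L : seq (int * seq nat)) : bool :=
  all (fun m => (size m.2 == k) && all (ltn^~ 7) m.2) L.

(** Interior product with the basis vector of index [i]; the sign is that of moving position [p] to
    the front. Every occurrence of [i] contributes, so monomials may be unsorted or have repeated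
    indices, and the wedge product is plain concatenation. *)
Definition lcontr1 (i : nat) (m : int * seq nat) : seq (int * seq nat) :=
  [seq ((-1) ^+ p * m.1, take p m.2 ++ drop p.+1 m.2)
     | p <- [seq p <- iota 0 (size m.2) | nth 0%N m.2 p == i]].

Definition lcontr (i : nat) (L : seq (int * seq nat)) : seq (int * seq nat) :=
  flatten [seq lcontr1 i m | m <- L].

Definition lwedge (L L' : seq (int * seq nat)) : seq (int * seq nat) :=
  [seq (m.1 * m'.1, m.2 ++ m'.2) | m <- L, m' <- L'].

(** After one contraction for each entry of [J], a well-formed list of degree [size J] contains only
    empty monomials, so the sum of the coefficients is the value on the basis vectors indexed by
    [J]. *)
Definition leval (L : seq (int * seq nat)) (J : seq nat) : int :=
  foldr (fun m x => m.1 + x) 0 (foldl (fun L j => lcontr j L) L J).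

Section ListForms.
Context (R : realType).
Implicit Types (L : seq (int * seq nat)) (s J : seq nat).

(** Selecting the columns [s ++ s'] gives a square matrix whose left and right column blocks carry
    the two factors, so [sum_det_blocks] applies. *)
Lemma wedge_mform k l s s' (v : 'M[R]_(k + l, 7)) :
  size s = k -> size s' = l -> wedge (@mform R k s) (@mform R l s') v = mform (s ++ s') v.
Proof.
move=> sk sl; rewrite /wedge /mform.
set m := colsub _ v.
under eq_bigr => t _.
  rewrite (_ : colsub _ (usubmx _) = lsubmx (usubmx (row_perm t m))); last first.
    by apply/matrixP=> i j; rewrite !mxE /= nth_cat sk ltn_ord.
  rewrite (_ : colsub _ (dsubmx _) = rsubmx (dsubmx (row_perm t m))); last first.
    by apply/matrixP=> i j; rewrite !mxE /= nth_cat sk ltnNge leq_addr /= addKn.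
  over.
rewrite sum_det_blocks mulKf //.
Qed.

Lemma wedge_lform k l L L' (v : 'M[R]_(k + l, 7)) :
  lform_wf k L -> lform_wf l L' ->
  wedge (@lform R k L) (@lform R l L') v = lform (lwedge L L') v.
Proof.
move=> /allP kL /allP lL'; rewrite wedge_suml /lform /lwedge big_allpairs_dep /=.
rewrite !big_seq; apply: eq_bigr => m /kL /andP[/eqP mk _].
rewrite wedge_sumr mulr_sumr !big_seq; apply: eq_bigr => m' /lL' /andP[/eqP ml _].
by rewrite wedge_mform // intrM mulrA.
Qed.

(** Laplace expansion along the inserted first row, whose entry in column [p] is 1 if the index at
    position [p] is [i] and 0 otherwise. *)
Lemma mform_contract k i s (v : 'M[R]_(k, 7)) :
  (i < 7)%N -> size s = k.+1 -> all (ltn^~ 7) s ->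
  @Defs.contract R k 7 (delta_mx 0 (inord i)) (@mform R k.+1 s) v = lform (lcontr1 i (1, s)) v.
Proof.
move=> i7 sk s7; rewrite /Defs.contract /mform (expand_det_row _ (ord0 : 'I_k.+1)).
rewrite /lform /lcontr1 big_map big_filter sk.
transitivity (\sum_(0 <= p < k.+1 | nth 0%N s p == i)
  (-1) ^+ p * mform (take p s ++ drop p.+1 s) v); last first.
  by apply: eq_bigr => p _ /=; rewrite mulr1 rmorphXn /= rmorphN1.
rewrite big_mkord [RHS]big_mkcond /=; apply: eq_bigr => p _.
have -> : colsub (fun j : 'I_k.+1 => inord (nth 0%N s j))
    (col_mx (delta_mx 0 (inord i) : 'rV[R]_7) v : 'M[R]_(k.+1, 7))
    (ord0 : 'I_k.+1) p = (nth 0%N s p == i)%:R.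
  have o0 : (ord0 : 'I_k.+1) = lshift k (ord0 : 'I_1) by exact: val_inj.
  rewrite mxE /= o0; apply: (etrans (col_mxEu _ _ _ _)).
  rewrite mxE /=; congr (_ %:R); rewrite -val_eqE /= !inordK //.
  by apply: (allP s7); rewrite mem_nth // sk ltn_ord.
case: eqP => _; last by rewrite mul0r.
rewrite mul1r /cofactor add0n; congr (_ * _); congr (\det _).
apply/matrixP=> x y; rewrite !mxE /=.
rewrite (_ : lift ord0 x = rshift 1 x); last by apply: val_inj; rewrite /= /bump.
case: splitP => [a /= ax|a /= [/ord_inj <-]]; first by have := ltn_ord a; rewrite -ax.
congr (v _ (inord _)).
rewrite nth_cat size_takel; last by rewrite sk ltnW ?ltn_ord.
rewrite /bump leqNgt; case: (ltnP y p) => [yp|py]; first by rewrite nth_take.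
by rewrite nth_drop addSn subnKC.
Qed.

Lemma lform_contract k i L (v : 'M[R]_(k, 7)) :
  (i < 7)%N -> lform_wf k.+1 L ->
  @Defs.contract R k 7 (delta_mx 0 (inord i)) (@lform R k.+1 L) v = lform (lcontr i L) v.
Proof.
move=> i7 /allP wL; rewrite /lform /lcontr big_flatten big_map /Defs.contract /lform.
rewrite !big_seq; apply: eq_bigr => m /wL /andP[/eqP sm am].
have := @mform_contract k i m.2 v i7 sm am; rewrite /Defs.contract => ->.
rewrite /lform !big_map mulr_sumr; apply: eq_bigr => p _ /=.
by rewrite mulr1 intrM mulrCA mulrA.
Qed.

Lemma lform_wf_contr k i L : lform_wf k.+1 L -> lform_wf k (lcontr i L).
Proof.
move=> /allP wL; apply/allP => m' /flatten_mapP [m /wL /andP[/eqP sm am]].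
case/mapP=> p; rewrite mem_filter mem_iota add0n sm /= => /andP[_ pk] -> /=.
apply/andP; split.
  by rewrite size_cat size_takel ?size_drop sm ?subSS ?subnKC // ltnW.
rewrite all_cat; apply/andP; split; apply/allP => x.
  by move/mem_take; apply: (allP am).
by move/mem_drop; apply: (allP am).
Qed.

Lemma bas_cons k j J : bas R k.+1 (j :: J) =
  col_mx (delta_mx 0 (inord j) : 'rV[R]_7) (bas R k J).
Proof.
apply/row_matrixP=> i; rewrite rowK.
case: (split_ordP (i : 'I_(1 + k))) => a ->.
  by apply/esym/(etrans (rowKu _ _ _)); rewrite ord1 row_id.
by apply/esym/(etrans (rowKd _ _ _)); rewrite rowK.
Qed.

Lemma lform_bas k L J : size J = k -> all (ltn^~ 7) J -> lform_wf k L ->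
  lform L (bas R k J) = (leval L J)%:~R.
Proof.
elim: J k L => [|j J IH] k L <- /=.
  move=> _ _; rewrite /leval /lform /=; elim: L => [|m L IHL] /=; first by rewrite big_nil.
  by rewrite big_cons IHL intrD /mform det_mx00 mulr1.
case/andP=> j7 J7 wL; have := lform_contract (bas R (size J) J) j7 wL.
by rewrite /Defs.contract -bas_cons => ->; rewrite IH // lform_wf_contr.
Qed.

(** Selecting columns of [v] is multiplication by a constant matrix, so every monomial is a constant
    multiple of the determinant; the total constant is the value on the standard basis. *)
Lemma lform_top L (v : 'M[R]_7) : lform_wf 7 L ->
  lform L v = \det v * (leval L (iota 0 7))%:~R.
Proof.
move=> wL; rewrite -(@lform_bas 7) //.
have -> : bas R 7 (iota 0 7) = 1%:M.
  apply/row_matrixP=> i; rewrite rowK row1 nth_iota // add0n inord_val //.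
rewrite /lform mulr_sumr; apply: eq_bigr => m _; rewrite mulrCA /mform -det_mulmx.
by rewrite mulmx_colsub mulmx1.
Qed.
End ListForms.

Section Contraction.
Context (R : realType).

Lemma row'_eqP k n (i : 'I_k) (A B : 'M[R]_(k, n)) :
  row' i A = row' i B <-> forall j, j != i -> row j A = row j B.
Proof.
split=> [/matrixP AB j ji|AB].
  apply/rowP=> c; rewrite !mxE.
  case: (unliftP i j) ji => [j' ->|->] ji; last by rewrite eqxx in ji.
  by have := AB j' c; rewrite !mxE.
apply/matrixP=> x c; have /rowP/(_ c) := AB (lift i x) (negbT (lift_eqF _ _)).
by rewrite !mxE.
Qed.

Lemma contract_multilinear k n (u : 'rV[R]_n) (w : 'M[R]_(1 + k, n) -> R) :
  multilinear w -> multilinear (Defs.contract u w).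
Proof.
move=> wL i a A B C AE /row'_eqP BE /row'_eqP CE.
apply: (wL (rshift 1 i)).
- by rewrite !rowKd.
- apply/row'_eqP => j; case: (split_ordP j) => c -> ci; first by rewrite !rowKu.
  by rewrite !rowKd BE //; apply: contraNneq ci => ->.
- apply/row'_eqP => j; case: (split_ordP j) => c -> ci; first by rewrite !rowKu.
  by rewrite !rowKd CE //; apply: contraNneq ci => ->.
Qed.

Lemma contract_linear k n a (u v : 'rV[R]_n) (w : 'M[R]_(1 + k, n) -> R) x :
  multilinear w ->
  Defs.contract (a *: u + v) w x = a * Defs.contract u w x + Defs.contract v w x.
Proof.
move=> wL; apply: (wL (lshift k ord0)).
- by rewrite !rowKu !row_id.
- apply/row'_eqP => j; case: (split_ordP j) => c -> ci; last by rewrite !rowKd.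
  by rewrite ord1 eqxx in ci.
- apply/row'_eqP => j; case: (split_ordP j) => c -> ci; last by rewrite !rowKd.
  by rewrite ord1 eqxx in ci.
Qed.

Lemma multilinear1 n (w : 'M[R]_(1, n) -> R) a u v :
  multilinear w -> w (a *: u + v) = a * w u + w v.
Proof.
by move=> wL; apply: (wL ord0); rewrite ?row_id //; apply/matrixP=> -[].
Qed.

Definition is_linear n (f : 'rV[R]_n -> R) : Prop :=
  forall a u v, f (a *: u + v) = a * f u + f v.

Lemma is_linearE n (f : 'rV[R]_n -> R) u : is_linear f ->
  f u = \sum_i u 0 i * f (delta_mx 0 i).
Proof.
move=> fL; have f0 : f 0 = 0.
  by have := fL (-1) 0 0; rewrite scaler0 addr0 mulN1r addNr.
rewrite {1}[u]row_sum_delta; elim/big_rec2: _ => [//|i y v _ IH].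
by rewrite fL IH.
Qed.

Lemma is_linear_ext n (f h : 'rV[R]_n -> R) : is_linear f -> is_linear h ->
  (forall i, f (delta_mx 0 i) = h (delta_mx 0 i)) -> f =1 h.
Proof.
move=> fL hL fh u; rewrite (is_linearE u fL) (is_linearE u hL).
by apply: eq_bigr => i _; rewrite fh.
Qed.
End Contraction.

(** * The standard 3-form and the inner product it induces *)

Definition phi0_list : seq (int * seq nat) :=
  [:: (1, [:: 0; 1; 2]%N); (1, [:: 0; 3; 4]%N); (1, [:: 0; 5; 6]%N);
      (1, [:: 1; 3; 5]%N); (-1, [:: 1; 4; 6]%N); (-1, [:: 2; 3; 6]%N);
      (-1, [:: 2; 4; 5]%N)].

Lemma lwedge_wf k l L L' : lform_wf k L -> lform_wf l L' ->
  lform_wf (k + l) (lwedge L L').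
Proof.
move=> /allP kL /allP lL'; apply/allP => _ /allpairsP[[m m'] /= [mL m'L ->]] /=.
have /andP[/eqP mk m7] := kL _ mL; have /andP[/eqP ml m'7] := lL' _ m'L.
by rewrite size_cat mk ml eqxx all_cat m7.
Qed.

Lemma phi0_wf : lform_wf 3 phi0_list. Proof. by []. Qed.

Definition dotv (R : realType) n (u v : 'rV[R]_n) : R := (u *m v^T) 0 0.

Section StandardForm.
Context (R : realType).

Lemma phi0E (v : 'M[R]_(3, 7)) : phi0 v = lform phi0_list v.
Proof.
have e3E i j k : e3 i j k v = mform [:: i.-1; j.-1; k.-1] v.
  congr (\det _); apply/matrixP=> x y; rewrite !mxE (tnth_nth ord0) /=.
  by case: y => -[|[|[|]]].
by rewrite /phi0 !e3E /lform unlock /= !rmorphN1 !rmorph1 !mul1r !mulN1r addr0 !addrA.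
Qed.

Lemma lform_multilinear k L : multilinear (@lform R k L).
Proof.
move=> i a A B C AE BE CE; rewrite /lform mulr_sumr -big_split /=.
apply: eq_bigr => m _; rewrite [a * _]mulrCA -mulrDr; congr (_ * _).
have [mL _] := is_form_det_colsub R (fun j : 'I_k => inord (nth 0%N m.2 j) : 'I_7).
exact: (mL i a A B C AE BE CE).
Qed.

Lemma contract_phi0 (u : 'rV[R]_7) :
  @Defs.contract R 2 7 u (@phi0 R) =
  fun x => \sum_(i < 7) u 0 i * lform (lcontr i phi0_list) x.
Proof.
apply/funext => x; rewrite (_ : @phi0 R = @lform R 3 phi0_list); last exact/funext/phi0E.
rewrite (@is_linearE R 7 (fun y => @Defs.contract R 2 7 y (@lform R 3 phi0_list) x)).
  by apply: eq_bigr => i _; rewrite -lform_contract // inord_val.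
by move=> a y z /=; apply: (@contract_linear R 2 7); apply: lform_multilinear.
Qed.

Lemma dotv_sum n (u v : 'rV[R]_n) : dotv u v = \sum_i u 0 i * v 0 i.
Proof. by rewrite /dotv mxE; apply: eq_bigr => i _; rewrite mxE. Qed.

Lemma dotv_delta n (i j : 'I_n) : dotv (delta_mx 0 i) (delta_mx 0 j) = (i == j)%:R :> R.
Proof. by rewrite /dotv trmx_delta mul_delta_mx_cond; case: eqP => _; rewrite !mxE ?eqxx. Qed.

Lemma sum_delta n (i : 'I_n) (f : 'I_n -> R) d :
  \sum_j f j * ((i == j)%:R * d) = f i * d.
Proof.
rewrite (bigD1 i) //= big1 ?eqxx ?mul1r ?addr0 // => j /negbTE ji.
by rewrite eq_sym ji mul0r mulr0.
Qed.

(** Both sides are bilinear in [u] and [v], and top forms in [x], so the identity reduces to one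
    integer for each of the 49 pairs of basis vectors. *)
Lemma phi0_metric (u v : 'rV[R]_7) (x : 'M[R]_7) :
  wedge (wedge (@Defs.contract R 2 7 u (@phi0 R)) (@Defs.contract R 2 7 v (@phi0 R)))
    (@phi0 R) x = 6%:R * dotv u v * \det x.
Proof.
pose L i j := lwedge (lwedge (lcontr i phi0_list) (lcontr j phi0_list)) phi0_list.
have check : all (fun i => all (fun j => lform_wf 7 (L i j) &&
    (leval (L i j) (iota 0 7) == ((i == j) * 6)%N)) (iota 0 7)) (iota 0 7).
  by vm_compute.
have termE (i j : 'I_7) :
    wedge (@lform R 4 (lwedge (lcontr i phi0_list) (lcontr j phi0_list)))
      (@lform R 3 phi0_list) x = (i == j)%:R * (6%:R * \det x).
  have /allP/(_ (j : nat)) : all (fun j : nat => lform_wf 7 (L i j) &&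
      (leval (L i j) (iota 0 7) == ((i == j :> nat) * 6)%N)) (iota 0 7).
    by apply: (allP check); rewrite mem_iota ltn_ord.
  rewrite mem_iota add0n ltn_ord => /(_ isT) /andP[wL /eqP evL].
  rewrite (@wedge_lform R 4 3 _ _ x _ phi0_wf).
    by rewrite (lform_top _ wL) evL mulrC -pmulrn natrM mulrA.
  exact: lwedge_wf (@lform_wf_contr 2 _ _ phi0_wf) (@lform_wf_contr 2 _ _ phi0_wf).
have phi0L : @phi0 R = @lform R 3 phi0_list by exact/funext/phi0E.
rewrite !contract_phi0 {}phi0L.
rewrite [X in wedge X](_ : _ = fun y => \sum_(i < 7) u 0 i * (\sum_(j < 7) v 0 j *
    @lform R 4 (lwedge (lcontr i phi0_list) (lcontr j phi0_list)) y)); last first.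
  apply/funext => y; rewrite wedge_suml; apply: eq_bigr => i _; congr (_ * _).
  rewrite wedge_sumr; apply: eq_bigr => j _; congr (_ * _).
  by apply: wedge_lform; apply: (@lform_wf_contr 2 _ _ phi0_wf).
rewrite wedge_suml dotv_sum mulrAC mulrC mulr_suml; apply: eq_bigr => i _.
rewrite wedge_suml; under eq_bigr do rewrite termE.
rewrite sum_delta; exact: mulrA.
Qed.
End StandardForm.

(** * The metric, the volume form and the dual 4-form of a positive 3-form *)

Section PositiveForm.
Context (R : realType) (g : 'M[R]_(2, 7) -> R) (vol : 'M[R]_7 -> R).
Context (w : 'M[R]_(3, 7) -> R) (E : 'M[R]_7).
Hypotheses (gI : is_inner g) (volV : is_volume g vol) (EU : E \in unitmx).
Hypothesis wE : forall v, w v = phi0 (v *m E).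
Hypothesis gw : forall u v x, ev2 g u v * vol x = 6%:R^-1 *
  wedge (wedge (@Defs.contract R 2 7 u w) (@Defs.contract R 2 7 v w)) w x.

Lemma dotvZ n a b (u v : 'rV[R]_n) : dotv (a *: u) (b *: v) = a * b * dotv u v.
Proof. by rewrite !dotv_sum mulr_sumr; apply: eq_bigr => i _; rewrite !mxE mulrACA. Qed.

(** Contraction and wedge commute with pullback along [E], so this is [phi0_metric] pulled back.
    Only the product of the metric and the volume form is determined so far. *)
Lemma ev2_vol u v x : ev2 g u v * vol x = dotv (u *m E) (v *m E) * \det (x *m E).
Proof.
have contractE y : @Defs.contract R 2 7 y w =
    fun z => @Defs.contract R 2 7 (y *m E) (@phi0 R) (z *m E).
  by apply/funext => z; rewrite /Defs.contract wE; congr phi0; apply: (mul_col_mx y z E).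
have wE' : w = fun z => phi0 (z *m E) by apply/funext.
have n6 : 6%:R != 0 :> R by rewrite pnatr_eq0.
have inner : wedge (@Defs.contract R 2 7 u w) (@Defs.contract R 2 7 v w) =
    fun y => wedge (@Defs.contract R 2 7 (u *m E) (@phi0 R))
      (@Defs.contract R 2 7 (v *m E) (@phi0 R)) (y *m E).
  by apply/funext => y; rewrite !contractE; apply/esym/wedge_mulmx.
rewrite gw inner [X in wedge _ X]wE'; apply: (mulfI n6); rewrite mulVKf // mulrA.
rewrite -(phi0_metric (u *m E) (v *m E) (x *m E)).
by apply/esym/(@wedge_mulmx R 4 3).
Qed.

(* Scaling the frame of [phi0] to a g-orthonormal one forces c^9 = 1. *)
Lemma positive_form_metric :
  (forall u v, ev2 g u v = dotv (u *m E) (v *m E)) /\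
  (forall x, vol x = \det (x *m E)).
Proof.
pose F := invmx E; pose u0 := row 0 F; pose c := ev2 g u0 u0.
have FE : F *m E = 1%:M by rewrite mulVmx.
have rowFE i : row i F *m E = delta_mx 0 i by rewrite -row_mul FE row1.
have u0N : u0 != 0.
  apply/eqP=> u00; have := rowFE 0; rewrite -/u0 u00 mul0mx => /rowP/(_ 0).
  by rewrite !mxE eqxx => /eqP; rewrite eq_sym oner_eq0.
have c_gt0 : 0 < c by case: gI => _ _; apply.
(* The vector [u0] is sent by [E] to a standard unit vector, so [ev2_vol] at (u0, u0) separates the
   volume form from the metric. *)
have cvol x : c * vol x = \det (x *m E).
  by rewrite ev2_vol rowFE dotv_delta eqxx mul1r.
have gE u v : ev2 g u v = c * dotv (u *m E) (v *m E).
  have := ev2_vol u v F; rewrite FE det1 mulr1 => <-.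
  by rewrite mulrCA cvol FE det1 mulr1.
pose s := Num.sqrt c; have s_gt0 : 0 < s by rewrite sqrtr_gt0.
have sN0 : s != 0 by rewrite gt_eqF.
have sc : s ^+ 2 = c by rewrite sqr_sqrtr // ltW.
pose e := s^-1 *: F.
have eO : Defs.orthonormal g e.
  move=> i j; rewrite gE /e !linearZ /= -!scalemxAl !rowFE dotvZ dotv_delta -sc.
  by rewrite mulrA -expr2 -exprMn mulfV // expr1n mul1r.
have vol1 : `|vol e| = 1 by case: volV => _; apply.
(* Since [e *m E] is s^-1 times the 7 x 7 identity, c vol(e) = s^-7; with |vol(e)| = 1 and c = s^2
   this gives s^2 = s^-7, hence s^9 = 1. *)
have s1 : s = 1.
  have := cvol e; rewrite /e -scalemxAl FE detZ det1 mulr1 -/e => /(congr1 Num.norm).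
  rewrite normrM vol1 mulr1 normrX normfV !gtr0_norm // -sc => sE.
  have s9 : s ^+ 9 = 1.
    by rewrite (exprD s 2 7) sE -exprMn mulVf // expr1n.
  by apply/eqP; rewrite -(@pexpr_eq1 _ s 9) ?ltW // s9.
have c1 : c = 1 by rewrite -sc s1 expr1n.
by split=> [u v|x]; rewrite -?cvol ?gE c1 mul1r.
Qed.

End PositiveForm.

(** * The dual 4-form on basis vectors *)

Definition compl7 (K : seq nat) : seq nat := [seq i <- iota 0 7 | i \notin K].

(* By [hodge_star_orthonormal], the value of the dual 4-form on the basis
   vectors with indices [K]. *)
Definition psi0_val (K : seq nat) : int :=
  if uniq K then
    leval phi0_list (compl7 K) * leval [:: (1, iota 0 7)] (compl7 K ++ K)
  else 0.

(* <e_i x e_j, e_k x e_l> - <e_i, e_k> <e_j, e_l> + <e_i, e_l> <e_j, e_k> *)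
Definition phi0_assoc (i j k l : nat) : int :=
  foldr (fun m x => leval phi0_list [:: i; j; m] * leval phi0_list [:: k; l; m] + x)
    0 (iota 0 7) - ((i == k) && (j == l))%:Z + ((i == l) && (j == k))%:Z.

(** The contraction identity phi_ijm phi_klm = g_ik g_jl - g_il g_jk + psi_ijkl for the standard
    form, checked on all 7^4 quadruples of indices. *)
Lemma psi0_valE (i j k l : 'I_7) :
  psi0_val [:: val i; val j; val k; val l] = phi0_assoc i j k l.
Proof.
have check : all (fun i => all (fun j => all (fun k => all (fun l =>
    psi0_val [:: i; j; k; l] == phi0_assoc i j k l)
  (iota 0 7)) (iota 0 7)) (iota 0 7)) (iota 0 7) by vm_compute.
have m7 (a : 'I_7) : (a : nat) \in iota 0 7 by rewrite mem_iota ltn_ord.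
exact/eqP/(allP (allP (allP (allP check _ (m7 i)) _ (m7 j)) _ (m7 k)) _ (m7 l)).
Qed.

Section DualForm.
Context (R : realType) (g : 'M[R]_(2, 7) -> R) (vol : 'M[R]_7 -> R).
Context (w : 'M[R]_(3, 7) -> R) (psi : 'M[R]_(4, 7) -> R) (E : 'M[R]_7).
Hypotheses (EU : E \in unitmx) (wF : is_form w).
Hypothesis wE : forall v, w v = phi0 (v *m E).
Hypothesis gE : forall u v, ev2 g u v = dotv (u *m E) (v *m E).
Hypothesis volE : forall x, vol x = \det (x *m E).
Hypothesis psiS : @is_hodge_star R 3 4 7 g vol w psi.

Lemma compl7_perm K : uniq K -> all (ltn^~ 7) K -> perm_eq (compl7 K ++ K) (iota 0 7).
Proof.
move=> Ku /allP K7; apply: uniq_perm; rewrite ?iota_uniq //.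
  rewrite cat_uniq Ku filter_uniq ?iota_uniq // andbT; apply/hasPn => x xK.
  by rewrite mem_filter xK.
move=> x; rewrite mem_cat mem_filter mem_iota add0n /=.
by have [xK|_] := boolP (x \in K); rewrite /= ?orbF //; apply/esym/(K7 x).
Qed.

(** With a repeated index both sides vanish. Otherwise the frame is reordered so that the complement
    of [K] comes first and [K] last: it stays orthonormal, and the sign of the reordering is its
    volume. *)
Lemma psi_bas K : size K = 4 -> all (ltn^~ 7) K ->
  psi (bas R 4 K *m invmx E) = (psi0_val K)%:~R.
Proof.
move=> K4 K7; have [psiF _] := psiS; rewrite /psi0_val.
have [Ku|Knu] := boolP (uniq K); last first.
  have [i [j [ij j4 nij]]] := uniqPn 0%N Knu; rewrite K4 in j4.
  have i4 := ltn_trans ij j4.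
  have [_ psiA] := psiF; rewrite mulr0z; apply: (psiA (Ordinal i4) (Ordinal j4)).
    by rewrite -val_eqE /= ltn_eqF.
  by rewrite !row_mul !rowK /= nij.
have KP := compl7_perm Ku K7; set I := compl7 K in KP *.
have I3 : size I = 3.
  by have := perm_size KP; rewrite size_cat K4 size_iota;
    move/(congr1 (subn^~ 4)); rewrite addnK.
have IKu : uniq (I ++ K) by rewrite (perm_uniq KP) iota_uniq.
have IK7 : all (ltn^~ 7) (I ++ K).
  by apply/allP=> x; rewrite (perm_mem KP) mem_iota.
have I7 : all (ltn^~ 7) I by move: IK7; rewrite all_cat => /andP[].
have IKs : size (I ++ K) = 7 by rewrite (perm_size KP) size_iota.
pose B := bas R 7 (I ++ K); pose e := B *m invmx E.
have eE : e *m E = B by rewrite mulmxKV.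
have nthIK (i j : 'I_7) :
    (inord (nth 0%N (I ++ K) i) == inord (nth 0%N (I ++ K) j) :> 'I_7) = (i == j).
  have nth7 (a : 'I_7) : (nth 0%N (I ++ K) a < 7)%N.
    by apply: (allP IK7); rewrite mem_nth // IKs.
  by rewrite -val_eqE /= !inordK // nth_uniq // IKs.
have eO : Defs.orthonormal g e.
  by move=> i j; rewrite gE -!row_mul eE !rowK dotv_delta nthIK.
have BdetE : \det B = (leval [:: (1, iota 0 7)] (I ++ K))%:~R.
  rewrite -(@lform_bas R 7) // /lform big_seq1 mul1r; congr (\det _).
  apply/matrixP=> i j; rewrite [RHS]mxE; congr (B _ _).
  by rewrite (nth_iota _ _ (ltn_ord j)) inord_val.
have eU : e \in unitmx.
  rewrite unitmx_mul unitmx_inv EU andbT.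
  (* The rows of [B] are the standard basis in another order, so its transpose is its inverse. *)
  have : B *m B^T = 1%:M.
    apply/matrixP=> i j; rewrite -[RHS]/((1%:M : 'M[R]_7) i j) [RHS]mxE -nthIK -dotv_delta.
    by rewrite dotv_sum !mxE; apply: eq_bigr => c _; rewrite !mxE.
  by case/mulmx1_unit.
have := @hodge_star_orthonormal R 3 4 g vol w psi e wF psiS eO eU.
rewrite volE eE BdetE wE => psiE.
have -> : bas R 4 K *m invmx E = @dsubmx R 3 4 7 e.
  rewrite /e -mul_dsub_mx; congr (_ *m _); apply/row_matrixP=> i.
  by apply/rowP=> j; rewrite !mxE nth_cat I3 ltnNge leq_addr /= addKn.
rewrite psiE phi0E intrM; congr (_ * _).
rewrite -(@lform_bas R 3) //; congr (lform _ _).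
rewrite mul_usub_mx eE; apply/row_matrixP=> i.
by apply/rowP=> j; rewrite !mxE nth_cat I3 /= ltn_ord.
Qed.

End DualForm.

(** * Linearity and antisymmetry in single arguments *)

Section LinearArguments.
Context (R : realType) (n : nat).
Implicit Types (f h : 'rV[R]_n -> R) (x y z t : 'rV[R]_n).

Lemma is_linearD f h : is_linear f -> is_linear h -> is_linear (fun x => f x + h x).
Proof. by move=> fL hL a u v; rewrite fL hL mulrDr addrACA. Qed.

Lemma is_linearMl c f : is_linear f -> is_linear (fun x => c * f x).
Proof. by move=> fL a u v; rewrite fL mulrDr mulrCA. Qed.

Lemma is_linearMr c f : is_linear f -> is_linear (fun x => f x * c).
Proof. by move=> fL a u v; rewrite fL mulrDl mulrA. Qed.

Lemma is_linearN f : is_linear f -> is_linear (fun x => - f x).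
Proof. by move=> fL a u v; rewrite fL opprD mulrN. Qed.

Lemma is_linear_sum m (f : 'I_m -> 'rV[R]_n -> R) : (forall i, is_linear (f i)) ->
  is_linear (fun x => \sum_i f i x).
Proof.
move=> fL a u v; rewrite mulr_sumr -big_split.
by apply: eq_bigr => i _; apply: fL.
Qed.

Lemma is_linear_mulmx m (f : 'rV[R]_m -> R) (F : 'M[R]_(n, m)) :
  is_linear f -> is_linear (fun x => f (x *m F)).
Proof. by move=> fL a u v; rewrite mulmxDl -scalemxAl fL. Qed.

Lemma is_linear_dotvl y : is_linear (fun x => dotv x y).
Proof. by move=> a u v; rewrite /dotv mulmxDl -scalemxAl !mxE. Qed.

Lemma dotvC x y : dotv x y = dotv y x.
Proof. by rewrite !dotv_sum; apply: eq_bigr => i _; apply: mulrC. Qed.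

Lemma is_linear_dotvr x : is_linear (dotv x).
Proof. by move=> a u v; rewrite ![dotv x _]dotvC is_linear_dotvl. Qed.

Lemma multilinear_col1 k (w : 'M[R]_(1 + k, n) -> R) A : multilinear w ->
  is_linear (fun x => w (col_mx x A)).
Proof. by move=> wL a u v; apply: contract_linear. Qed.

Lemma multilinear_col2 k (w : 'M[R]_(1 + (1 + k), n) -> R) x A : multilinear w ->
  is_linear (fun y => w (col_mx x (col_mx y A))).
Proof. by move=> /(contract_multilinear x); apply: multilinear_col1. Qed.

Lemma multilinear_col3 k (w : 'M[R]_(1 + (1 + (1 + k)), n) -> R) x y A :
  multilinear w -> is_linear (fun z => w (col_mx x (col_mx y (col_mx z A)))).
Proof. by move=> /(contract_multilinear x); apply: multilinear_col2. Qed.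

Lemma multilinear_row2 (w : 'M[R]_(1 + 1, n) -> R) x :
  multilinear w -> is_linear (fun y => w (col_mx x y)).
Proof. by move=> /(contract_multilinear x) wL a u v; apply: (multilinear1 a u v wL). Qed.

Lemma multilinear_row3 (w : 'M[R]_(1 + (1 + 1), n) -> R) x y :
  multilinear w -> is_linear (fun z => w (col_mx x (col_mx y z))).
Proof. by move=> /(contract_multilinear x); apply: multilinear_row2. Qed.

Lemma multilinear_row4 (w : 'M[R]_(1 + (1 + (1 + 1)), n) -> R) x y z :
  multilinear w -> is_linear (fun t => w (col_mx x (col_mx y (col_mx z t)))).
Proof. by move=> /(contract_multilinear x); apply: multilinear_row3. Qed.
End LinearArguments.

Section Swaps.
Context (R : realType) (n : nat).
Implicit Types (x y z t : 'rV[R]_n).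

Lemma natr_and (b b' : bool) : (b && b')%:R = b%:R * b'%:R :> R.
Proof. by case: b; rewrite ?mul1r ?mul0r. Qed.

Lemma contract_form k x (w : 'M[R]_(1 + k, n) -> R) :
  is_form w -> is_form (Defs.contract x w).
Proof.
case=> wL wA; split; first exact: contract_multilinear.
move=> i j A nij AE; apply: (wA (rshift 1 i) (rshift 1 j)).
  by rewrite (inj_eq (@rshift_inj _ _)).
by rewrite !rowKd.
Qed.

Lemma bilinear_swap (f : 'rV[R]_n -> 'rV[R]_n -> R) x y :
  (forall u, is_linear (f u)) -> (forall v, is_linear (fun u => f u v)) ->
  (forall u, f u u = 0) -> f x y = - f y x.
Proof.
move=> fr fl f0; apply/eqP; rewrite -addr_eq0; apply/eqP.
have := f0 (1 *: x + y); rewrite fl !fr !f0 !mul1r add0r addr0 => <-.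
by [].
Qed.

Lemma form_swap k (w : 'M[R]_(1 + (1 + k), n) -> R) x y A : is_form w ->
  w (col_mx x (col_mx y A)) = - w (col_mx y (col_mx x A)).
Proof.
move=> [wL wA]; apply: (bilinear_swap (f := fun u v => w (col_mx u (col_mx v A)))).
- by move=> u; apply: multilinear_col2.
- by move=> v; apply: multilinear_col1.
- move=> u; apply: (wA (lshift _ ord0) (rshift 1 (lshift _ ord0))).
    by rewrite eq_lrshift.
  by rewrite rowKu rowKd rowKu.
Qed.

Lemma form_swap2 (w : 'M[R]_(1 + 1, n) -> R) x y : is_form w ->
  w (col_mx x y) = - w (col_mx y x).
Proof.
move=> [wL wA]; apply: (bilinear_swap (f := fun u v => w (col_mx u v))).
- by move=> u; apply: multilinear_row2.
- by move=> v; apply: multilinear_col1.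
- move=> u; apply: (wA (lshift _ ord0) (rshift 1 ord0)); first by rewrite eq_lrshift.
  by rewrite rowKu rowKd.
Qed.

Lemma form_cycle3 (w : 'M[R]_(1 + (1 + 1), n) -> R) x y z : is_form w ->
  w (col_mx x (col_mx y z)) = w (col_mx y (col_mx z x)).
Proof.
move=> wF; rewrite form_swap //.
by have := form_swap2 x z (contract_form y wF); rewrite /Defs.contract => ->; rewrite opprK.
Qed.

Lemma form_cycle4 (w : 'M[R]_(1 + (1 + (1 + 1)), n) -> R) x y z t : is_form w ->
  w (col_mx x (col_mx y (col_mx z t))) = - w (col_mx y (col_mx z (col_mx t x))).
Proof.
move=> wF; rewrite form_swap //; congr (- _).
exact: (form_cycle3 x z t (contract_form y wF)).
Qed.

Lemma form_cycle31 k (w : 'M[R]_(1 + (1 + (1 + k)), n) -> R) x y z A : is_form w ->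
  w (col_mx x (col_mx y (col_mx z A))) = w (col_mx y (col_mx z (col_mx x A))).
Proof.
move=> wF; rewrite form_swap //.
by have := form_swap x z A (contract_form y wF); rewrite /Defs.contract => ->; rewrite opprK.
Qed.
End Swaps.

(** * The dual 4-form, the cross product and the associator *)

Section CrossProductIdentity.
Context (R : realType) (g : 'M[R]_(2, 7) -> R) (vol : 'M[R]_7 -> R).
Context (w : 'M[R]_(1 + (1 + 1), 7) -> R).
Context (psi : 'M[R]_(1 + (1 + (1 + 1)), 7) -> R) (E : 'M[R]_7).
Hypotheses (EU : E \in unitmx) (wF : is_form w).
Hypothesis wE : forall v, w v = phi0 (v *m E).
Hypothesis gE : forall u v, ev2 g u v = dotv (u *m E) (v *m E).
Hypothesis volE : forall x, vol x = \det (x *m E).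
Hypothesis psiS : @is_hodge_star R 3 4 7 g vol w psi.

Let F := invmx E.
Let p4 x y z t : R := psi (col_mx (x *m F) (col_mx (y *m F) (col_mx (z *m F) (t *m F)))).
Let p3 x y z : R := w (col_mx (x *m F) (col_mx (y *m F) (z *m F))).

(** Both sides are linear in each of the four arguments, which are replaced by basis vectors one at
    a time; what remains is [psi_bas] combined with [psi0_valE]. The vectors are given in the
    coordinates in which [w] becomes [phi0]. *)
Lemma psi_standard x y z t : p4 x y z t =
  \sum_(m < 7) p3 x y (delta_mx 0 m) * p3 z t (delta_mx 0 m)
  - dotv x z * dotv y t + dotv x t * dotv y z.
Proof.
have [[psiL _] _] := psiS; have [wL _] := wF.
move: t; apply: is_linear_ext => [||l].
- exact: (is_linear_mulmx _ (multilinear_row4 _ _ _ psiL)).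
- apply: is_linearD; last by apply: is_linearMr; apply: is_linear_dotvr.
  apply: is_linearD; last by apply/is_linearN/is_linearMl/is_linear_dotvr.
  apply: is_linear_sum => m; apply: is_linearMl.
  exact: (is_linear_mulmx _ (multilinear_col2 _ _ wL)).
move: z; apply: is_linear_ext => [||k].
- exact: (is_linear_mulmx _ (multilinear_col3 _ _ _ psiL)).
- apply: is_linearD; last by apply: is_linearMl; apply: is_linear_dotvr.
  apply: is_linearD; last by apply/is_linearN/is_linearMr/is_linear_dotvr.
  apply: is_linear_sum => m; apply: is_linearMl.
  exact: (is_linear_mulmx _ (multilinear_col1 _ wL)).
move: y; apply: is_linear_ext => [||j].
- exact: (is_linear_mulmx _ (multilinear_col2 _ _ psiL)).
- apply: is_linearD; last by apply: is_linearMl; apply: is_linear_dotvl.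
  apply: is_linearD; last by apply/is_linearN/is_linearMl/is_linear_dotvl.
  apply: is_linear_sum => m; apply: is_linearMr.
  exact: (is_linear_mulmx _ (multilinear_col2 _ _ wL)).
move: x; apply: is_linear_ext => [||i].
- exact: (is_linear_mulmx _ (multilinear_col1 _ psiL)).
- apply: is_linearD; last by apply: is_linearMr; apply: is_linear_dotvl.
  apply: is_linearD; last by apply/is_linearN/is_linearMr/is_linear_dotvl.
  apply: is_linear_sum => m; apply: is_linearMr.
  exact: (is_linear_mulmx _ (multilinear_col1 _ wL)).
have bas1 (m : 'I_7) : delta_mx 0 m = bas R 1 [:: val m] :> 'rV[R]_7.
  by apply/row_matrixP => c; rewrite ord1 rowK row_id /= inord_val.
have p3E a b m : p3 (delta_mx 0 a) (delta_mx 0 b) (delta_mx 0 m) =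
    (leval phi0_list [:: val a; val b; val m])%:~R.
  rewrite /p3 -!mul_col_mx wE mulmxKV // phi0E -(@lform_bas R 3) //=; last by rewrite !ltn_ord.
  by rewrite (bas_cons R 2) (bas_cons R 1) -!bas1 !inord_val.
rewrite !dotv_delta; under eq_bigr do rewrite !p3E -intrM.
have -> : p4 (delta_mx 0 i) (delta_mx 0 j) (delta_mx 0 k) (delta_mx 0 l) =
    psi (bas R 4 [:: val i; val j; val k; val l] *m invmx E).
  rewrite /p4 -!mul_col_mx (bas_cons R 3) (bas_cons R 2) (bas_cons R 1) -!bas1.
  by rewrite !inord_val.
rewrite (psi_bas EU wF wE gE volE psiS) //=; last by rewrite !ltn_ord.
rewrite psi0_valE /phi0_assoc intrD intrB -!pmulrn !natr_and; congr (_ - _ + _).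
have foldE (f : nat -> int) r : foldr (fun m x => f m + x) 0 r = \sum_(m <- r) f m.
  by elim: r => [|m r IH]; rewrite ?big_nil // big_cons -IH.
rewrite (foldE (fun m => _ * _)) -[iota 0 7]/(index_iota 0 7) big_mkord.
by rewrite rmorph_sum.
Qed.

(** The sum over [m] in [psi_standard] is the expansion of the inner product of two cross products
    in the orthonormal frame formed by the rows of [F]. *)
Lemma psi_cross (c : 'rV[R]_7 -> 'rV[R]_7 -> 'rV[R]_7) x y z t :
  (forall u v s, ev2 g (c u v) s = w (col_mx u (col_mx v s))) ->
  psi (col_mx x (col_mx y (col_mx z t))) =
  ev2 g (c x y) (c z t) - ev2 g x z * ev2 g y t + ev2 g x t * ev2 g y z.
Proof.
move=> cE; have EF u : u *m E *m F = u by rewrite mulmxK.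
have := psi_standard (x *m E) (y *m E) (z *m E) (t *m E).
rewrite /p4 !EF => ->; rewrite !gE; congr (_ - _ + _); rewrite dotv_sum; apply: eq_bigr => m _.
have coordE u : (u *m E) 0 m = ev2 g u (delta_mx 0 m *m F).
  rewrite gE mulmxKV // dotv_sum (bigD1 m) //= big1 => [|j /negbTE jm].
    by rewrite [delta_mx _ _ _ _]mxE !eqxx mulr1 addr0.
  by rewrite [delta_mx _ _ _ _]mxE jm andbF mulr0.
by rewrite !coordE !cE /p3 !EF.
Qed.

(* Since psi(t, a, b, z) = psi(a, b, t, z) = - psi(b, t, z, a), this is the
   difference of two instances of [psi_cross]. *)
Lemma psi_associator (c : 'rV[R]_7 -> 'rV[R]_7 -> 'rV[R]_7) a b t z :
  (forall u v s, ev2 g (c u v) s = w (col_mx u (col_mx v s))) ->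
  2%:R * psi (col_mx t (col_mx a (col_mx b z))) =
  ev2 g (c (c a b) t) z - ev2 g (c a (c b t)) z
  - ev2 g a b * ev2 g t z + ev2 g b t * ev2 g a z.
Proof.
move=> cE; have [psiF _] := psiS.
have gC u v : ev2 g u v = ev2 g v u by rewrite !gE dotvC.
have abt : psi (col_mx t (col_mx a (col_mx b z))) = psi (col_mx a (col_mx b (col_mx t z))).
  exact: form_cycle31.
have btz : psi (col_mx a (col_mx b (col_mx t z))) = - psi (col_mx b (col_mx t (col_mx z a))).
  exact: form_cycle4.
have -> : ev2 g (c (c a b) t) z = ev2 g (c a b) (c t z).
  by rewrite cE form_cycle3 // -cE gC.
have -> : ev2 g (c a (c b t)) z = ev2 g (c b t) (c z a).
  by rewrite cE form_cycle3 // form_cycle3 // -cE gC.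
have -> : 2%:R * psi (col_mx t (col_mx a (col_mx b z))) =
    psi (col_mx a (col_mx b (col_mx t z))) - psi (col_mx b (col_mx t (col_mx z a))).
  by rewrite mulr_natl mulr2n abt {2}btz.
rewrite (psi_cross _ _ _ _ cE) (psi_cross _ _ _ _ cE) (gC t a) (gC b a).
move: (ev2 g (c a b) _) (ev2 g (c b t) _) => p q.
move: (ev2 g a t) (ev2 g b z) (ev2 g a z) (ev2 g b t) (ev2 g a b) (ev2 g t z).
by move=> *; ring.
Qed.

End CrossProductIdentity.

(** * Functions of class C^k *)

Section SmoothFunctions.
Local Open Scope classical_set_scope.
Context (R : realType) (n : nat).
Implicit Types (W : normedModType R) (U : set 'rV[R]_n) (k : nat).

(** Functions read in a chart have junk values outside its image, so they can be replaced only near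
    a point. The first-order expansion is a statement about germs, and uniqueness of the
    differential does the rest. *)
Lemma near_eq_diff W (f h : 'rV[R]_n -> W) x :
  (\forall y \near x, f y = h y) -> differentiable f x ->
  differentiable h x /\ 'd h x = 'd f x :> ('rV[R]_n -> W).
Proof.
move=> fh df; have [dfc fE] := (diff_locallyP x f).1 df.
have hE : h \o shift x = cst (h x) + 'd f x +o_ 0 id.
  apply/eqaddoP => e e0; have [+ _] := eqaddoP
    (nbhs (0 : 'rV[R]_n)) (f \o shift x) (cst (f x) + 'd f x) id.
  move=> /(_ fE e e0); have fh0 : \forall y \near (0 : 'rV[R]_n), f (y + x) = h (y + x).
    by move: fh; rewrite (near_shift 0) subr0.
  have fhx : f x = h x by exact: nbhs_singleton fh.
  by apply: filterS2 fh0 => y fy; rewrite !fctE /= -fy -fhx.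
have dE := diff_unique dfc hE; split; last exact: dE.
by apply/diff_locallyP; rewrite dE; split; [exact: dfc | exact: hE].
Qed.

Lemma Ck_eq W k U (f h : 'rV[R]_n -> W) : open U ->
  (forall x, U x -> f x = h x) -> Ck k U f -> Ck k U h.
Proof.
move=> Uo; have nearU x (f' h' : 'rV[R]_n -> W) : U x -> (forall x, U x -> f' x = h' x) ->
    \forall y \near x, f' y = h' y.
  by move=> Ux fh; apply: filterS fh _; apply: open_nbhs_nbhs.
elim: k f h => [|k IH] f h fh /= fC.
  move=> x Ux; rewrite /prop_for /continuous_at -(fh _ Ux).
  by apply: (cvg_trans _ (fC x Ux)); apply: near_eq_cvg (nearU x f h Ux fh).
have [fd fC'] := fC; have hd x Ux := near_eq_diff (nearU x _ _ Ux fh) (fd x Ux).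
split=> [x Ux|v]; first by have [] := hd x Ux.
apply: IH (fC' v) => x Ux.
exact: (esym (congr1 (fun F : 'rV[R]_n -> W => F v) (hd x Ux).2)).
Qed.

Lemma CkW W k U (f : 'rV[R]_n -> W) : Ck k.+1 U f -> Ck k U f.
Proof.
elim: k f => [|k IH] f /= [fd fC].
  by move=> x Ux; apply: differentiable_continuous; apply: fd.
by split=> // v; apply: IH.
Qed.

Lemma Ck_cst W k U (a : W) : Ck k U (fun=> a).
Proof.
elim: k a => [|k IH] a /=; first by move=> x _; apply: cst_continuous.
split=> [x _|v]; first exact: differentiable_cst.
have -> : (fun x => 'd (fun=> a) x v) = fun=> 0; last exact: IH.
by apply/funext => x; rewrite diff_cst.
Qed.

Lemma CkD W k U (f h : 'rV[R]_n -> W) : open U ->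
  Ck k U f -> Ck k U h -> Ck k U (fun x => f x + h x).
Proof.
move=> Uo; elim: k f h => [|k IH] f h /=.
  by move=> fC hC x Ux; apply: cvgD (fC x Ux) (hC x Ux).
move=> [fd fC] [hd hC]; split=> [x Ux|v].
  by apply: differentiableD; [apply: fd|apply: hd].
apply: (Ck_eq Uo _ (IH _ _ (fC v) (hC v))) => x Ux.
exact: (esym (congr1 (fun F : 'rV[R]_n -> W => F v) (diffD (fd _ Ux) (hd _ Ux)))).
Qed.

Lemma Ck_sum W k U (I : Type) (r : seq I) (P : pred I) (f : I -> 'rV[R]_n -> W) : open U ->
  (forall i, Ck k U (f i)) -> Ck k U (fun x => \sum_(i <- r | P i) f i x).
Proof.
move=> Uo fC; elim: r => [|i r IH].
  by apply: Ck_eq (Ck_cst k U 0) => // x Ux; rewrite big_nil.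
case Pi : (P i); last by apply: Ck_eq IH => // x Ux; rewrite big_cons Pi.
by apply: Ck_eq (CkD Uo (fC i) IH) => // x Ux; rewrite big_cons Pi.
Qed.

Lemma CkM k U (f h : 'rV[R]_n -> R) : open U ->
  Ck k U f -> Ck k U h -> Ck k U (fun x => f x * h x).
Proof.
move=> Uo; elim: k f h => [|k IH] f h.
  by move=> fC hC x Ux; apply: cvgM (fC x Ux) (hC x Ux).
move=> fC hC; have [fd fC'] := fC; have [hd hC'] := hC; split=> [x Ux|v].
  by apply: differentiableM; [apply: fd|apply: hd].
apply: (Ck_eq Uo _ (CkD Uo (IH _ _ (CkW fC) (hC' v)) (IH _ _ (CkW hC) (fC' v)))) => x Ux.
exact: (esym (congr1 (fun F : 'rV[R]_n -> R => F v) (diffM (fd _ Ux) (hd _ Ux)))).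
Qed.

Lemma Ck_prod k U (I : Type) (r : seq I) (P : pred I) (f : I -> 'rV[R]_n -> R) : open U ->
  (forall i, Ck k U (f i)) -> Ck k U (fun x => \prod_(i <- r | P i) f i x).
Proof.
move=> Uo fC; elim: r => [|i r IH].
  by apply: Ck_eq (Ck_cst k U (1 : R)) => // x Ux; rewrite big_nil.
case Pi : (P i); last by apply: Ck_eq IH => // x Ux; rewrite big_cons Pi.
by apply: Ck_eq (CkM Uo (fC i) IH) => // x Ux; rewrite big_cons Pi.
Qed.

(** The differential of 1/f is -(1/f)^2 df, so the induction hypothesis for 1/f one order lower
    closes the step. *)
Lemma CkV k U (f : 'rV[R]_n -> R) : open U -> (forall x, U x -> f x != 0) ->
  Ck k U f -> Ck k U (fun x => (f x)^-1).
Proof.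
move=> Uo f0; elim: k => [|k IH].
  by move=> fC x Ux; apply: cvgV (f0 x Ux) (fC x Ux).
move=> fC; have [fd fC'] := fC; split=> [x Ux|v].
  by apply: differentiableV; [apply: fd|apply: f0].
have fVC := IH (CkW fC).
apply: (Ck_eq Uo _ (CkM Uo (CkM Uo (Ck_cst k U (-1 : R)) (CkM Uo fVC fVC)) (fC' v))) => x Ux.
rewrite (_ : -1 * _ = - (f x) ^- 2); last by rewrite mulN1r -expr2 exprVn.
exact: (esym (congr1 (fun F : 'rV[R]_n -> R => F v) (diffV (fd _ Ux) (f0 _ Ux)))).
Qed.

Lemma Ck_lin W W' k U (f : 'rV[R]_n -> W) (L : {linear W -> W'}) : open U ->
  continuous L -> Ck k U f -> Ck k U (fun x => L (f x)).
Proof.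
move=> Uo Lc; elim: k f => [|k IH] f /=.
  by move=> fC x Ux; apply: continuous_comp; [apply: fC|apply: Lc].
move=> [fd fC]; have Ld x : differentiable L x by exact: linear_differentiable.
split=> [x Ux|v]; first by apply: differentiable_comp; [apply: fd|apply: Ld].
apply: (Ck_eq Uo _ (IH _ (fC v))) => x Ux.
apply/esym/(etrans (congr1 (fun F : 'rV[R]_n -> W' => F v) (diff_comp (fd _ Ux) (Ld _)))).
exact: (congr1 (fun F : W -> W' => F ('d f x v)) (diff_lin _ Lc)).
Qed.

Lemma Ck_coord m k U (f : 'rV[R]_n -> 'rV[R]_m) j : open U ->
  Ck k U f -> Ck k U (fun x => f x 0 j).
Proof.
move=> Uo fC.
have lin : linear (fun v : 'rV[R]_m => v 0 j : R) by move=> a u v; rewrite !mxE.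
pose LM := GRing.isLinear.Build _ _ _ _ _ lin.
pose L : {linear 'rV[R]_m -> R} := HB.pack (fun v : 'rV[R]_m => v 0 j : R) LM.
by apply: (Ck_lin (L := L)) => //; apply: coord_continuous.
Qed.

Lemma Ck_scalel W k U (f : 'rV[R]_n -> R) (a : W) : open U ->
  Ck k U f -> Ck k U (fun x => f x *: a).
Proof.
move=> Uo fC.
have lin : linear (fun c : R => c *: a) by move=> c u v; rewrite scalerDl -scalerA.
pose LM := GRing.isLinear.Build _ _ _ _ _ lin.
pose L : {linear R -> W} := HB.pack (fun c : R => c *: a) LM.
by apply: (Ck_lin (L := L)) => //; apply: scalel_continuous.
Qed.

Lemma Ck_row m k U (f : 'rV[R]_n -> 'rV[R]_m) : open U ->
  (forall j, Ck k U (fun x => f x 0 j)) -> Ck k U f.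
Proof.
move=> Uo fC.
apply: Ck_eq (Ck_sum (index_enum _) predT Uo
  (fun j => Ck_scalel (delta_mx 0 j : 'rV[R]_m) Uo (fC j))) => // x Ux.
by rewrite -row_sum_delta.
Qed.

Lemma Ck_det m k U (A : 'rV[R]_n -> 'M[R]_m) : open U ->
  (forall i j, Ck k U (fun x => A x i j)) -> Ck k U (fun x => \det (A x)).
Proof.
by move=> Uo AC; apply: Ck_sum => // s; apply: CkM => //; [apply: Ck_cst|apply: Ck_prod].
Qed.

(** Cramer's rule: an entry of the inverse is a cofactor divided by the determinant. *)
Lemma Ck_invmx m k U (A : 'rV[R]_n -> 'M[R]_m) i j : open U ->
  (forall x, U x -> A x \in unitmx) ->
  (forall i j, Ck k U (fun x => A x i j)) -> Ck k U (fun x => invmx (A x) i j).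
Proof.
move=> Uo AU AC.
have detV : Ck k U (fun x => (\det (A x))^-1).
  by apply: CkV (Ck_det Uo AC) => // x /AU; rewrite unitmxE unitfE.
have adjC : Ck k U (fun x => cofactor (A x) j i).
  apply: CkM => //; first exact: Ck_cst.
  apply: Ck_det => // a b; apply: Ck_eq (AC (lift j a) (lift i b)) => // x _.
  by rewrite !mxE.
apply: Ck_eq (CkM Uo detV adjC) => // x /AU Ax.
by rewrite /invmx Ax !mxE.
Qed.
End SmoothFunctions.

(** * Inner products and charts *)

Section InnerProducts.
Context (R : realType) (n : nat) (g : 'M[R]_(2, n) -> R) (gI : is_inner g).

Let gL : multilinear g. Proof. by case: gI. Qed.

Lemma ev2_linearl v : is_linear (fun u => ev2 g u v).
Proof. exact: (multilinear_col1 _ (gL : multilinear (g : 'M[R]_(1 + 1, n) -> R))). Qed.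

Lemma ev2_linearr u : is_linear (ev2 g u).
Proof. exact: (multilinear_row2 _ (gL : multilinear (g : 'M[R]_(1 + 1, n) -> R))). Qed.

Lemma ev2Dl u v z : ev2 g (u + v) z = ev2 g u z + ev2 g v z.
Proof. by have := ev2_linearl z 1 u v; rewrite scale1r mul1r. Qed.

Lemma ev2Zl a u z : ev2 g (a *: u) z = a * ev2 g u z.
Proof.
have z0 : ev2 g 0 z = 0.
  by have := ev2_linearl z (-1) 0 0; rewrite scaler0 addr0 mulN1r addNr.
by have := ev2_linearl z a u 0; rewrite addr0 z0 addr0.
Qed.

Lemma ev2Nl u z : ev2 g (- u) z = - ev2 g u z.
Proof. by rewrite -scaleN1r ev2Zl mulN1r. Qed.

Lemma ev2C u v : ev2 g u v = ev2 g v u.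
Proof. by case: gI => _ + _; apply. Qed.

Lemma inner_eq0 u : ev2 g u u = 0 -> u = 0.
Proof.
case: gI => _ _ gp uu; apply/eqP; apply: contra_eqT uu => /gp.
by rewrite lt0r => /andP[].
Qed.

Lemma ev2Dr u v z : ev2 g z (u + v) = ev2 g z u + ev2 g z v.
Proof. by rewrite !(ev2C z) ev2Dl. Qed.

Lemma ev2Zr a u z : ev2 g z (a *: u) = a * ev2 g z u.
Proof. by rewrite !(ev2C z) ev2Zl. Qed.

Lemma ev2Nr u z : ev2 g z (- u) = - ev2 g z u.
Proof. by rewrite !(ev2C z) ev2Nl. Qed.

Lemma inner_ext u v : (forall z, ev2 g u z = ev2 g v z) -> u = v.
Proof.
move=> uv; apply/eqP; rewrite -subr_eq0; apply/eqP/inner_eq0.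
by rewrite ev2Dl ev2Nl uv subrr.
Qed.

(** The map [L] chooses the frame: the identity when a dual vector is constructed at one point, and
    the coordinate frame of a chart when its smoothness is proved. *)
Definition gram (L : 'rV[R]_n -> 'rV[R]_n) : 'M[R]_n :=
  \matrix_(i, j) ev2 g (L (delta_mx 0 i)) (L (delta_mx 0 j)).

Lemma gramE (L : 'rV[R]_n -> 'rV[R]_n) u j : linear L ->
  (u *m gram L) 0 j = ev2 g (L u) (L (delta_mx 0 j)).
Proof.
move=> LL; rewrite mxE.
rewrite [RHS](is_linearE (f := fun z => ev2 g (L z) (L (delta_mx 0 j)))).
  by apply: eq_bigr => i _; rewrite mxE.
by move=> a x y; rewrite LL ev2_linearl.
Qed.

(** A vector u in the kernel would satisfy g(Lu, Lu) = 0, so definiteness and injectivity of [L]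
    force u = 0. *)
Lemma gram_unit (L : 'rV[R]_n -> 'rV[R]_n) : linear L ->
  (forall u, L u = 0 -> u = 0) -> gram L \in unitmx.
Proof.
move=> LL L0; rewrite unitmxE unitfE; apply/det0P => -[u u0 uG].
move/eqP: u0; apply; apply/L0/inner_eq0.
rewrite (is_linearE (f := fun z => ev2 g (L u) (L z)) u); last first.
  by move=> a x y; rewrite LL ev2_linearr.
by rewrite big1 // => j _; rewrite -gramE // uG mxE mulr0.
Qed.

(** [sharp] is a choice with default 0; the inverse Gram matrix supplies a vector dual to [f], so
    the chosen vector has the required property. *)
Lemma sharpE (f : 'rV[R]_n -> R) v : is_linear f -> ev2 g (sharp g f) v = f v.
Proof.
move=> fL; have GU := gram_unit (L := id) (fun _ _ _ => erefl) (fun _ => id).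
suff H : exists u, forall v, ev2 g u v = f v by exact: (xgetPex 0 H).
exists ((\row_j f (delta_mx 0 j)) *m invmx (gram id)) => {}v.
apply: (is_linear_ext (ev2_linearr _) fL) => j.
by rewrite -(gramE (L := id)) // mulmxKV // mxE.
Qed.

End InnerProducts.

Section Charts.
Context (R : realType) (n : nat) (M : smoothManifold R n).
Implicit Types (c : chart R n M) (p : M) (X Y : vfield M) (f : M -> R).

Lemma chart_at_atlas p : atlas (chart_at p).
Proof. by rewrite /chart_at; case: cid => c /= []. Qed.

Lemma chart_at_dom p : chart_dom (chart_at p) p.
Proof. by rewrite /chart_at; case: cid => c /= []. Qed.

Lemma chart_img_open_set c : open (chart_img c).
Proof. exact: chart_img_open. Qed.

Lemma chart_of_dom c x : chart_img c x -> chart_dom c (chart_of c x).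
Proof. by case=> p pc <-; rewrite chart_toK. Qed.

Lemma chart_ofK c x : chart_img c x -> chart_to c (chart_of c x) = x.
Proof. by case=> p pc <-; rewrite chart_toK. Qed.

Lemma transition_diff c c' p : atlas c -> atlas c' -> chart_dom c p -> chart_dom c' p ->
  differentiable (chart_to c' \o chart_of c) (chart_to c p).
Proof.
move=> ca ca' cp cp'; have [] := atlas_compatible ca ca' 1%N => + _; apply.
by exists p.
Qed.

(** The chain rule for the two transition maps, whose composite is the identity only near the point;
    there its differential is still the identity by [near_eq_diff]. *)
Lemma diff_transitionK c c' p v : atlas c -> atlas c' -> chart_dom c p -> chart_dom c' p ->
  'd (chart_to c' \o chart_of c) (chart_to c p)
    ('d (chart_to c \o chart_of c') (chart_to c' p) v) = v.
Proof.
move=> ca ca' cp cp'; set x := chart_to c' p.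
have x_img : chart_img c' x by exists p.
have Exp : chart_to c p = (chart_to c \o chart_of c') x by rewrite /= chart_toK.
have d1 := transition_diff ca' ca cp' cp.
have d2 := transition_diff ca ca' cp cp'.
have near_id : \forall y \near x,
    y = ((chart_to c' \o chart_of c) \o (chart_to c \o chart_of c')) y.
  have cc : \forall y \near x, chart_dom c (chart_of c' y).
    have := @chart_of_cont _ _ _ c' x x_img; apply.
    by apply: open_nbhs_nbhs; split; [exact: chart_dom_open | rewrite chart_toK].
  have ci : \forall y \near x, chart_img c' y.
    by apply: open_nbhs_nbhs; split; first exact: chart_img_open_set.
  by apply: filterS2 cc ci => y yc yi /=; rewrite chart_toK // chart_ofK.
have idd : differentiable (fun y : 'rV[R]_n => y) x by [].
have [_ dE] := near_eq_diff near_id idd.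
rewrite Exp in d2 *.
rewrite -[LHS]/(('d (chart_to c' \o chart_of c) ((chart_to c \o chart_of c') x) \o
  'd (chart_to c \o chart_of c') x) v) -(diff_comp d1 d2) dE.
exact: (congr1 (fun F : 'rV[R]_n -> 'rV[R]_n => F v) (diff_val (is_diff_def := is_diff_id x))).
Qed.

Lemma of_chartK c p v : atlas c -> chart_dom c p -> to_chart c p (of_chart c p v) = v.
Proof.
by move=> ca cp; apply: diff_transitionK (chart_at_dom p) cp => //; apply: chart_at_atlas.
Qed.

Lemma to_chartK c p v : atlas c -> chart_dom c p -> of_chart c p (to_chart c p v) = v.
Proof.
by move=> ca cp; apply: diff_transitionK cp (chart_at_dom p) => //; apply: chart_at_atlas.
Qed.

Lemma of_chart_linear c p : linear (of_chart c p).
Proof. by move=> a u v; rewrite /of_chart linearP. Qed.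

End Charts.

(** * Smooth fields *)

Section SmoothFields.
Context (R : realType) (n : nat) (M : smoothManifold R n).
Implicit Types (c : chart R n M) (p : M) (X Y : vfield M) (f h : M -> R).

Lemma is_linear_of_chart c p (f : 'rV[R]_n -> R) :
  is_linear f -> is_linear (fun u => f (of_chart c p u)).
Proof. by move=> fL a u v; rewrite of_chart_linear fL. Qed.

Lemma smooth_funM f h : smooth_fun f -> smooth_fun h -> smooth_fun (fun p => f p * h p).
Proof.
by move=> fs hs c ca k; apply: CkM (fs c ca k) (hs c ca k); apply: chart_img_open_set.
Qed.

Lemma smooth_fun_cst a : smooth_fun (fun _ : M => a).
Proof. by move=> c ca k; apply: Ck_cst. Qed.

Lemma smooth_vfieldD X Y : smooth_vfield X -> smooth_vfield Y ->
  smooth_vfield (fun p => X p + Y p).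
Proof.
move=> Xs Ys c ca k; have Uo := @chart_img_open_set _ _ _ c.
apply: Ck_eq (CkD Uo (Xs c ca k) (Ys c ca k)) => // x _.
by rewrite /to_chart linearD.
Qed.

Lemma smooth_vfieldZ f X : smooth_fun f -> smooth_vfield X ->
  smooth_vfield (fun p => f p *: X p).
Proof.
move=> fs Xs c ca k; have Uo := @chart_img_open_set _ _ _ c.
apply: (Ck_row Uo) => j.
apply: Ck_eq (CkM Uo (fs c ca k) (Ck_coord j Uo (Xs c ca k))) => // x _ /=.
by rewrite /to_chart linearZ mxE.
Qed.

Lemma smooth_vfieldN X : smooth_vfield X -> smooth_vfield (fun p => - X p).
Proof.
move=> Xs; have := smooth_vfieldZ (smooth_fun_cst (-1)) Xs.
by under eq_fun do rewrite scaleN1r.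
Qed.

(** In a chart the components are the sums over j of X^j w(d_j, ...), with d_j the coordinate
    fields. Writing [X] through [to_chartK] brings out its components X^j. *)
Lemma smooth_contract k (w : tfield M (1 + k)) X :
  smooth_tfield w -> (forall p, multilinear (w p)) -> smooth_vfield X ->
  smooth_tfield (fun p => Defs.contract (X p) (w p)).
Proof.
move=> ws wL Xs c ca v d; have Uo := @chart_img_open_set _ _ _ c.
apply: Ck_eq (Ck_sum (index_enum 'I_n) predT Uo (fun j =>
  CkM Uo (Ck_coord j Uo (Xs c ca d)) (ws c ca (col_mx (delta_mx 0 j) v) d))) => // x xc.
set q := chart_of c x; set A := \matrix_i _.
rewrite /Defs.contract -[in RHS](to_chartK (X q) ca (chart_of_dom xc)).
rewrite [RHS](is_linearE _ (is_linear_of_chart c q (multilinear_col1 A (wL q)))).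
apply: eq_bigr => j _; congr (_ * w q _).
apply/row_matrixP => i; rewrite rowK; case: (split_ordP i) => a ->.
  by rewrite rowKu ord1 row_id rowKu row_id.
by rewrite !rowKd rowK.
Qed.

Lemma smooth_eval1 (w : tfield M 1) X :
  smooth_tfield w -> (forall p, multilinear (w p)) -> smooth_vfield X ->
  smooth_fun (fun p => w p (X p)).
Proof.
move=> ws wL Xs c ca d; have Uo := @chart_img_open_set _ _ _ c.
apply: Ck_eq (Ck_sum (index_enum 'I_n) predT Uo (fun j =>
  CkM Uo (Ck_coord j Uo (Xs c ca d)) (ws c ca (delta_mx 0 j) d))) => // x xc.
rewrite /=; set q := chart_of c x.
rewrite -[in RHS](to_chartK (X q) ca (chart_of_dom xc)).
have wL1 : is_linear (w q) by move=> a u v; apply: multilinear1.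
rewrite [RHS](is_linearE _ (is_linear_of_chart c q wL1)).
apply: eq_bigr => j _; congr (_ * w q _).
by apply/row_matrixP => i; rewrite rowK ord1 !row_id.
Qed.

(* In a chart the components of the field are obtained from those of [w] by
   the inverse of the Gram matrix of [g]. *)
Lemma smooth_sharp (g : tfield M 2) (w : tfield M 1) : riemannian g ->
  smooth_tfield w -> (forall p, multilinear (w p)) ->
  smooth_vfield (fun p => sharp (g p) (w p)).
Proof.
move=> [gs gI] ws wL c ca d; have Uo := @chart_img_open_set _ _ _ c.
pose G x := gram (g (chart_of c x)) (of_chart c (chart_of c x)).
have GU x : chart_img c x -> G x \in unitmx.
  move=> xc; apply: (gram_unit (gI _)); first exact: of_chart_linear.
  move=> u u0; rewrite -(of_chartK u ca (chart_of_dom xc)) u0.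
  by rewrite /to_chart linear0.
have GC i j : Ck d (chart_img c) (fun x => G x i j).
  apply: Ck_eq (gs c ca (col_mx (delta_mx 0 i : 'rV_n) (delta_mx 0 j)) d) => // x xc.
  rewrite mxE; congr (g _ _); apply/row_matrixP => a.
  rewrite rowK; case: (split_ordP (a : 'I_(1 + 1))) => b ->.
    by rewrite (rowKu b (delta_mx 0 i : 'rV[R]_n)) [RHS]rowKu ord1 !row_id.
  by rewrite (rowKd b (delta_mx 0 i : 'rV[R]_n)) [RHS]rowKd ord1 !row_id.
apply: (Ck_row Uo) => j.
apply: Ck_eq (Ck_sum (index_enum 'I_n) predT Uo (fun i =>
  CkM Uo (ws c ca (delta_mx 0 i) d) (Ck_invmx i j Uo GU GC))) => // x xc.
set q := chart_of c x; set Y := sharp _ _.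
have wL1 : is_linear (w q) by move=> a u v; apply: multilinear1.
have YE : to_chart c q Y *m G x = \row_i w q (of_chart c q (delta_mx 0 i)).
  apply/rowP => i; rewrite gramE //; last exact: of_chart_linear.
  by rewrite to_chartK //; [rewrite sharpE ?mxE | exact: chart_of_dom].
rewrite -[to_chart c q Y](mulmxK (GU _ xc)) YE mxE; apply: eq_bigr => i _.
rewrite [in RHS]mxE; congr (w q _ * _).
by apply/row_matrixP => a; rewrite rowK ord1 !row_id.
Qed.

Lemma smooth_fun_diff f p : smooth_fun f ->
  differentiable (f \o chart_of (chart_at p)) (chart_to (chart_at p) p).
Proof.
move=> fs; have [] := fs _ (chart_at_atlas p) 1%N => + _; apply.
by exists p => //; apply: chart_at_dom.
Qed.

Lemma vderivB X f h p : smooth_fun f -> smooth_fun h ->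
  vderiv X (fun q => f q - h q) p = vderiv X f p - vderiv X h p.
Proof.
move=> /(smooth_fun_diff p) fd /(smooth_fun_diff p) hd.
exact: (congr1 (fun F : 'rV[R]_n -> R => F (X p)) (diffB fd hd)).
Qed.

Lemma vderivM X f h p : smooth_fun f -> smooth_fun h ->
  vderiv X (fun q => f q * h q) p = f p * vderiv X h p + h p * vderiv X f p.
Proof.
move=> /(smooth_fun_diff p) fd /(smooth_fun_diff p) hd.
have E := congr1 (fun F : 'rV[R]_n -> R => F (X p)) (diffM fd hd).
apply: (etrans E); rewrite /= !chart_toK //; exact: chart_at_dom.
Qed.

End SmoothFields.

(** * The octonion covariant derivative *)

Section CovariantDerivatives.
Context (R : realType) (n : nat) (M : smoothManifold R n).
Implicit Types (X A B C : vfield M) (p : M).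

Lemma matrix_cons k (f : 'I_k.+1 -> 'rV[R]_n) :
  \matrix_(j < k.+1) f j =
  col_mx (f ord0 : 'rV[R]_n) (\matrix_(j < k) f (lift ord0 j)) :> 'M[R]_(1 + k, n).
Proof.
apply/row_matrixP => i; rewrite rowK; case: (split_ordP i) => a ->.
  by rewrite rowKu row_id; congr (f _); apply: val_inj; rewrite /= ord1.
by rewrite rowKd rowK; congr (f _); apply: val_inj.
Qed.

Lemma matrix1 (f : 'I_1 -> 'rV[R]_n) : \matrix_(j < 1) f j = f ord0.
Proof. by apply/row_matrixP => i; rewrite rowK ord1 row_id. Qed.

Lemma matrix2 (f : 'I_2 -> 'rV[R]_n) : \matrix_(j < 2) f j =
  col_mx (f ord0 : 'rV[R]_n) (f (lift ord0 ord0)) :> 'M[R]_(1 + 1, n).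
Proof. by rewrite matrix_cons matrix1. Qed.

Lemma matrix3 (f : 'I_3 -> 'rV[R]_n) : \matrix_(j < 3) f j =
  col_mx (f ord0 : 'rV[R]_n) (col_mx (f (lift ord0 ord0) : 'rV[R]_n)
    (f (lift ord0 (lift ord0 ord0)))) :> 'M[R]_(1 + (1 + 1), n).
Proof. by rewrite matrix_cons matrix2. Qed.

Definition vfields2 A B (i : 'I_2) : vfield M :=
  if val i is 0%N then A else B.

Definition vfields3 A B C (i : 'I_3) : vfield M :=
  match val i with 0%N => A | 1%N => B | _ => C end.

Lemma cov_deriv2 nabla X (g : tfield M 2) A B p :
  cov_deriv nabla X g (vfields2 A B) p =
  vderiv X (fun q => ev2 (g q) (A q) (B q)) p
  - (ev2 (g p) (nabla X A p) (B p) + ev2 (g p) (A p) (nabla X B p)).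
Proof.
rewrite /cov_deriv !big_ord_recl big_ord0 addr0.
rewrite (_ : (fun q => _) = (fun q => ev2 (g q) (A q) (B q))); last first.
  by apply/funext => q; rewrite /ev2 matrix2.
by rewrite /ev2 !matrix2.
Qed.

Lemma cov_deriv3 nabla X (w : tfield M (1 + (1 + 1))) A B C p :
  cov_deriv nabla X w (vfields3 A B C) p =
  vderiv X (fun q => w q (col_mx (A q) (col_mx (B q) (C q)))) p
  - (w p (col_mx (nabla X A p) (col_mx (B p) (C p)))
     + (w p (col_mx (A p) (col_mx (nabla X B p) (C p)))
     + w p (col_mx (A p) (col_mx (B p) (nabla X C p))))).
Proof.
rewrite /cov_deriv !big_ord_recl big_ord0 addr0.
rewrite (_ : (fun q => _) = (fun q => w q (col_mx (A q) (col_mx (B q) (C q))))); last first.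
  by apply/funext => q; rewrite matrix3.
by rewrite !matrix3.
Qed.

End CovariantDerivatives.

(** * Covariant derivatives of the cross product and of the octonion product *)

Section G2Manifold.
Context (R : realType) (M : smoothManifold R 7).
Context (phi : tfield M 3) (g : tfield M 2) (vol : tfield M 7) (psi : tfield M 4).
Context (nabla : vfield M -> vfield M -> vfield M) (T : tfield M 2).
Hypotheses (Hphi : G2_structure phi) (Hgvol : G2_metric_volume phi g vol).
Hypotheses (Hpsi : hodge_dual_field g vol phi psi) (Hnabla : levi_civita g nabla).
Hypothesis HT : torsion_tensor g phi psi nabla T.
Implicit Types (X Y Z : vfield M) (p : M).

Let phiF p : is_form (phi p). Proof. by have [_ /(_ p) []] := Hphi. Qed.
Let gI p : is_inner (g p). Proof. by have [[_ gI] _ _ _] := Hgvol; apply: gI. Qed.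
Let gR : riemannian g. Proof. by have [] := Hgvol. Qed.
Let phiL p : multilinear (phi p). Proof. by have [] := phiF p. Qed.

Let crs p u v := cross g phi p u v.

Lemma crossE p u v z : ev2 (g p) (crs p u v) z =
  (phi p : 'M[R]_(1 + (1 + 1), 7) -> R) (col_mx u (col_mx v z)).
Proof.
rewrite /crs /cross sharpE //.
by have := @multilinear_row3 R 7 (phi p) u v (phiL p).
Qed.

(** The vector on the right is the imaginary part of (ab)t - a(bt); its multiples of [t] and [a]
    come from the real parts of ab and bt. *)
Lemma torsion_associator p a b t z :
  2%:R * (psi p : 'M[R]_(1 + (1 + (1 + 1)), 7) -> R) (col_mx t (col_mx a (col_mx b z))) =
  ev2 (g p) (crs p (crs p a b) t - crs p a (crs p b t)
             - ev2 (g p) a b *: t + ev2 (g p) b t *: a) z.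
Proof.
have [_ /(_ p) [_ [E EU phiE]]] := Hphi.
have [_ _ volV gvol] := Hgvol.
have [gE volE] := positive_form_metric (gI p) (volV p) EU phiE (gvol p).
have [_ psiS] := Hpsi.
have -> := psi_associator EU (phiF p) phiE gE volE (psiS p) a b t z (@crossE p).
by rewrite !ev2Dl // !ev2Nl // !ev2Zl.
Qed.

(** Needed before [nabla] may be applied to a cross product, which is two contractions followed by
    raising an index. *)
Lemma smooth_cross X Y : smooth_vfield X -> smooth_vfield Y ->
  smooth_vfield (fun p => crs p (X p) (Y p)).
Proof.
move=> Xs Ys; have [phis _] := Hphi.
pose w1 : tfield M 2 := fun p => @Defs.contract R 2 7 (X p) (phi p).
have w1s : smooth_tfield w1 by apply: (@smooth_contract R 7 M 2).
have w1L p : multilinear (w1 p) by apply: (@contract_multilinear R 2).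
apply: (smooth_sharp gR (w := fun p => @Defs.contract R 1 7 (Y p) (w1 p))).
  exact: (@smooth_contract R 7 M 1).
by move=> p; apply: (@contract_multilinear R 1).
Qed.

Lemma smooth_contract_sharp X : smooth_vfield X -> smooth_vfield (contract_sharp g T X).
Proof.
move=> Xs; have [Ts TL _] := HT.
apply: (smooth_sharp gR (w := fun p => @Defs.contract R 1 7 (X p) (T p))).
  exact: (@smooth_contract R 7 M 1).
by move=> p; apply: (@contract_multilinear R 1).
Qed.

Lemma smooth_ev2 X Y : smooth_vfield X -> smooth_vfield Y ->
  smooth_fun (fun p => ev2 (g p) (X p) (Y p)).
Proof.
move=> Xs Ys; have [gs _] := gR; have gL p : multilinear (g p) by have [] := gI p.
apply: (smooth_eval1 (w := fun p => @Defs.contract R 1 7 (X p) (g p))) => //.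
  exact: (@smooth_contract R 7 M 1).
by move=> p; apply: (@contract_multilinear R 1).
Qed.

Lemma vderiv_ev2 X Y Z p : smooth_vfield X -> smooth_vfield Y -> smooth_vfield Z ->
  vderiv X (fun q => ev2 (g q) (Y q) (Z q)) p =
  ev2 (g p) (nabla X Y p) (Z p) + ev2 (g p) (Y p) (nabla X Z p).
Proof.
move=> Xs Ys Zs; have [_ _ gC] := Hnabla; apply/eqP; rewrite -subr_eq0 -cov_deriv2.
by apply/eqP/gC => // i; rewrite /vfields2; case: (val i).
Qed.

(* The difference of the two sides is a smooth field, so it can be tested
   against itself: no extension of tangent vectors to fields is needed. *)
Lemma nabla_cross X Y Z p : smooth_vfield X -> smooth_vfield Y -> smooth_vfield Z ->
  let t := contract_sharp g T X p in
  nabla X (fun q => crs q (Y q) (Z q)) p =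
  crs p (nabla X Y p) (Z p) + crs p (Y p) (nabla X Z p)
  + (crs p (crs p (Y p) (Z p)) t - crs p (Y p) (crs p (Z p) t)
     - ev2 (g p) (Y p) (Z p) *: t + ev2 (g p) (Z p) t *: Y p).
Proof.
move=> Xs Ys Zs t; have [[nablaS _ _ _] _ _] := Hnabla; have [_ _ HTE] := HT.
(* The torsion vector is kept as a field, because the whole right-hand side has to be a smooth
   field. *)
pose t' := contract_sharp g T X.
pose rhs q := crs q (nabla X Y q) (Z q) + crs q (Y q) (nabla X Z q)
  + (crs q (crs q (Y q) (Z q)) (t' q) - crs q (Y q) (crs q (Z q) (t' q))
     - ev2 (g q) (Y q) (Z q) *: t' q + ev2 (g q) (Z q) (t' q) *: Y q).
pose lhs := nabla X (fun q => crs q (Y q) (Z q)).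
have ts : smooth_vfield t' by apply: smooth_contract_sharp.
have YZs := smooth_cross Ys Zs.
have lhs_s : smooth_vfield lhs by apply: nablaS.
have rhs_s : smooth_vfield rhs.
  do !apply: smooth_vfieldD; do ?apply: smooth_vfieldN; do ?apply: smooth_vfieldZ;
    do ?apply: smooth_ev2; do ?apply: smooth_cross; by [|apply: nablaS|apply: smooth_cross].
(* The function g(Y x Z, V) = phi(Y, Z, V) is differentiated in two ways, by metric compatibility
   and by the torsion equation. The terms with the derivative of V agree and cancel. *)
have testE V q : smooth_vfield V -> ev2 (g q) (lhs q) (V q) = ev2 (g q) (rhs q) (V q).
  move=> Vs; have := vderiv_ev2 q Xs YZs Vs.
  under [in LHS]eq_fun do rewrite crossE.
  have YZV i : smooth_vfield (vfields3 Y Z V i) by rewrite /vfields3; case: (val i) => [|[|]].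
  have := HTE X (vfields3 Y Z V) Xs YZV q.
  rewrite cov_deriv3 matrix3 /Defs.contract torsion_associator => /(canRL (subrK _)) ->.
  rewrite -!crossE /rhs /lhs => E.
  apply: (addIr (ev2 (g q) (crs q (Y q) (Z q)) (nabla X V q))).
  by rewrite -E /t' /vfields3 /= !(ev2Dl (gI q)); ring.
suff E : lhs p = rhs p by exact: E.
have diff_s := smooth_vfieldD lhs_s (smooth_vfieldN rhs_s).
apply/eqP; rewrite -subr_eq0; apply/eqP/(inner_eq0 (gI p)).
have := testE _ p diff_s; rewrite [X in _ -> X = _]ev2Dl // ev2Nl // => ->.
by rewrite subrr.
Qed.

Lemma crossDl p u v z : crs p (u + v) z = crs p u z + crs p v z.
Proof.
apply: (inner_ext (gI p)) => t; rewrite ev2Dl // !crossE.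
by have := multilinear_col1 (col_mx z t) (phiL p) 1 u v; rewrite scale1r mul1r.
Qed.

Lemma crossZl p a u z : crs p (a *: u) z = a *: crs p u z.
Proof.
apply: (inner_ext (gI p)) => t; rewrite ev2Zl // !crossE.
have L := multilinear_col1 (col_mx z t) (phiL p).
have := L (-1) 0 0; rewrite scaler0 addr0 mulN1r addNr => z0.
by have := L a u 0; rewrite z0 !addr0.
Qed.

Lemma crossC p u v : crs p u v = - crs p v u.
Proof.
apply: (inner_ext (gI p)) => t; rewrite ev2Nl // !crossE.
exact: (form_swap u v t (phiF p)).
Qed.

Lemma crossDr p z u v : crs p z (u + v) = crs p z u + crs p z v.
Proof. by rewrite ![crs p z _]crossC crossDl opprD. Qed.

Lemma crossZr p a z u : crs p z (a *: u) = a *: crs p z u.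
Proof. by rewrite ![crs p z _]crossC crossZl scalerN. Qed.

Lemma crossNr p z u : crs p z (- u) = - crs p z u.
Proof. by rewrite -scaleN1r crossZr scaleN1r. Qed.

(** Equivalently, the associator has zero real part; this settles the scalar component of the
    product rule. *)
Lemma ev2_crossA p a b t : ev2 (g p) (crs p a b) t = ev2 (g p) a (crs p b t).
Proof. by rewrite (ev2C (gI p) a) !crossE (form_cycle3 a b t (phiF p)). Qed.

Lemma smooth_oct_mul (A B : octfield M) : smooth_octfield A -> smooth_octfield B ->
  [/\ smooth_fun (fun q => (A q).1 * (B q).1),
      smooth_fun (fun q => ev2 (g q) (A q).2 (B q).2),
      smooth_vfield (fun q => (A q).1 *: (B q).2),
      smooth_vfield (fun q => (B q).1 *: (A q).2) &
      smooth_vfield (fun q => crs q (A q).2 (B q).2)].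
Proof.
move=> [a1 a2] [b1 b2]; split; [exact: smooth_funM|exact: smooth_ev2| | |exact: smooth_cross];
  exact: smooth_vfieldZ.
Qed.

Lemma oct_D_mul (A B : octfield M) X p :
  smooth_octfield A -> smooth_octfield B -> smooth_vfield X ->
  oct_D g phi nabla T X (oct_mul g phi A B) p =
  oct_mul g phi (oct_nabla nabla X A) B p + oct_mul g phi A (oct_D g phi nabla T X B) p.
Proof.
move=> HA HB Xs; have [abS gabS abV baV crsV] := smooth_oct_mul HA HB.
have [a1 a2] := HA; have [b1 b2] := HB.
have [[_ _ nablaD nablaZ] _ _] := Hnabla.
have nablaE : nabla X (fun q => (oct_mul g phi A B q).2) p =
    (vderiv X (fun q => (A q).1) p *: (B p).2 + (A p).1 *: nabla X (fun q => (B q).2) p)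
    + (vderiv X (fun q => (B q).1) p *: (A p).2 + (B p).1 *: nabla X (fun q => (A q).2) p)
    + nabla X (fun q => crs q (A q).2 (B q).2) p.
  rewrite -!nablaZ // -nablaD // -nablaD //; exact: smooth_vfieldD.
have vderivE : vderiv X (fun q => (oct_mul g phi A B q).1) p =
    (A p).1 * vderiv X (fun q => (B q).1) p + (B p).1 * vderiv X (fun q => (A q).1) p
    - (ev2 (g p) (nabla X (fun q => (A q).2) p) (B p).2
       + ev2 (g p) (A p).2 (nabla X (fun q => (B q).2) p)).
  by rewrite -vderivM // -vderiv_ev2 // -vderivB.
(* From here on the claim is algebra at the point [p]: the associator produced by [nabla_cross]
   makes up the difference between (AB) T_X and A (B T_X). *)
rewrite /oct_D {1}/oct_nabla vderivE nablaE nabla_cross // /oct_mul /oct_torsion /oct_nabla.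
rewrite -![cross g phi p _ _]/(crs p _ _).
set t := contract_sharp g T X p.
move: (vderiv X _ p) (vderiv X _ p) (nabla X _ p) (nabla X _ p) => xa xb nb na.
move: (A p) (B p) => [a u] [b v]; have gIp := gI p.
apply: injective_projections => /=.
  rewrite !(ev2Dl gIp) !(ev2Zl gIp) !(ev2Dr gIp) !(ev2Nr gIp) !(ev2Dr gIp) !(ev2Zr gIp).
  by rewrite -ev2_crossA; ring.
(* Once bilinearity has expanded all cross products, those left can be treated as arbitrary vectors,
   and the vector component is a ring identity in each coordinate. *)
rewrite !crossDl !crossZl !crossDr crossNr !crossDr !crossZr.
move: (crs p _ _) (crs p _ _) (crs p _ _) => c1 c2 c3.
move: (crs p _ _) (crs p _ _) (crs p _ _) => c4 c5 c6.
move: (ev2 _ _ _) (ev2 _ _ _) => g1 g2; move: t => {}t.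
by apply/rowP => j; rewrite !mxE; ring.
Qed.

End G2Manifold.

Theorem proposition6p4 (R : realType) (M : smoothManifold R 7)
    (phi : tfield M 3) (g : tfield M 2) (vol : tfield M 7) (psi : tfield M 4)
    (nabla : vfield M -> vfield M -> vfield M) (T : tfield M 2)
    (Hphi : G2_structure phi)
    (Hgvol : G2_metric_volume phi g vol)
    (Hpsi : hodge_dual_field g vol phi psi)
    (Hnabla : levi_civita g nabla)
    (HT : torsion_tensor g phi psi nabla T)
    (A B : octfield M) (X : vfield M)
    (HA : smooth_octfield A) (HB : smooth_octfield B) (HX : smooth_vfield X) :
  forall p : M,
    oct_D g phi nabla T X (oct_mul g phi A B) p =
    oct_mul g phi (oct_nabla nabla X A) B p
    + oct_mul g phi A (oct_D g phi nabla T X B) p.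
Proof. by move=> p; apply: (oct_D_mul Hphi Hgvol Hpsi Hnabla HT). Qed.
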